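(* Let $n,m\geq1$, define $m_0$, $H=\mathrm{CK}(n)^*(\mathrm{SO}_m)$, $H_0=\mathrm{CK}(n)^*(\mathrm{SO}_{m_0})$ and $H\to H_0$ as follows: $m_0=m$ if $m\le2^{n+1}$, and for $m>2^{n+1}$, $m_0=2^{n+1}-1$ ($m$ odd) or $m_0=2^{n+1}$ ($m$ even); $H\to H_0$ is pullback along $\mathrm{SO}_{m_0}\hookrightarrow\mathrm{SO}_m$. Let $e_1,\dots,e_s$ ($s=\lfloor\frac{m-1}{2}\rfloor$) be generators of $H$ with $H\cong\mathbb F_2[v_n][e_1,\dots,e_s]/(e_i^2=e_{2i},\ v_ne_i=0\ (i\ge2^n))$ and co-multiplication as in the paper's description of $\mathrm{CK}(n)^*(\mathrm{SO}_m)$ (i.e. $\widetilde\Delta(e_{\langle 2k\rangle})=\sum_{i=0}^{\nu_2(k)}v_n^{i+1}e_{\langle k/2^i\rangle}\otimes e_{\langle k/2^i\rangle}\prod_{j<i}(e_{\langle k/2^j\rangle}\otimes1+1\otimes e_{\langle k/2^j\rangle})$ for $0<k<2^{n-1}$, $\widetilde\Delta(e_{2^n-1})=v_ne_{2^n-1}\otimes e_{2^n-1}$, $\widetilde\Delta(e_{2k-1})=0$ for $k>2^{n-1}$, where $\langle t\rangle=2^n-1-t$, $e_j=0$ for $j>s$). Let $I$ be a homogeneous bi-ideal of $H$ whose image $I_0$ in $H_0$ is saturated. Then, with $r=\lfloor\frac{s+1}{2}\rfloor$, $$I=\big(e_1^{2^{a_1}},e_3^{2^{a_2}},\dots,e_{2r-1}^{2^{a_r}}\big)$$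 for some integers $a_i\geq0$; in particular $I$ is determined by its image modulo $v_n$.
   Context: Base field of characteristic $0$, prime $2$; $\mathrm{CK}(n)^*=\Omega^*\otimes_{\mathbb L}\mathbb F_2[v_n]$ algebraic connective Morava K-theory, $\deg e_i=i$, $|v_n|=1-2^n$; $\mathrm{SO}_m$ split special orthogonal group; Hopf structure via group multiplication; $\widetilde\Delta(x)=\Delta(x)-x\otimes1-1\otimes x$; $\nu_2$ the $2$-adic valuation. A bi-ideal is an ideal $I$ with $\Delta(I)\subseteq I\otimes H+H\otimes I$ and $\varepsilon(I)=0$; an ideal $N$ of an $\mathbb F_2[v_n]$-module is saturated if $v_nx\in N$ implies $x\in N$. *)

(* Defs.v *)
From HB Require Import structures.
From mathcomp Require Import all_boot all_order all_algebra.
From mathcomp Require Import mpoly.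
Unset Printing Implicit Defensive.
Import GRing.Theory.
Local Open Scope ring_scope.

(* Model of H = CK(n)^*(SO_m) = F_2[v_n][e_1..e_s]/(e_i^2 = e_{2i},           *)
(*  v_n e_i = 0 (i >= 2^n)),  s = floor((m-1)/2).                              *)
(* We work in the polynomial ring  A s := F_2[v, x_1, ..., x_s]               *)
(*   = {mpoly 'F_2[s.+1]}  (variable 0 is v = v_n, variable i is x_i = e_i),  *)
(* and H = A s / Rel n s.  An ideal of H is represented by its preimage in    *)
(* A s, i.e. an ideal of A s containing Rel n s.                               *)
(* H (x)_{F_2[v]} H = B s / (Rel(x) + Rel(y)) where                           *)
(*   B s := F_2[v, x_1..x_s, y_1..y_s] = {mpoly 'F_2[(2 s).+1]}.               *)

Notation F2 := ('F_2 : fieldType).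
Notation A s := {mpoly F2[s.+1]}.
Notation B s := {mpoly F2[(2 * s).+1]}.

Definition mvar (N k : nat) : {mpoly F2[N]} :=
  if @insub nat (fun i => (i < N)%N) _ k is Some i then 'X_(i : 'I_N) else 0.

Definition vA (s : nat) : A s := mvar s.+1 0.
Definition eA (s j : nat) : A s := if (1 <= j <= s)%N then mvar s.+1 j else 0.

(** v_n, e_j (x) 1 and 1 (x) e_j in B s. *)
Definition vB (s : nat) : B s := mvar (2 * s).+1 0.
Definition ex (s j : nat) : B s := if (1 <= j <= s)%N then mvar (2 * s).+1 j else 0.
Definition ey (s j : nat) : B s :=
  if (1 <= j <= s)%N then mvar (2 * s).+1 (s + j) else 0.

Definition gen_ideal {R : comNzRingType} (G : R -> Prop) (p : R) : Prop :=
  exists cs : seq (R * R),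
    (forall c, c \in cs -> G c.2) /\ p = \sum_(c <- cs) c.1 * c.2.

Definition is_ideal {R : comNzRingType} (I : R -> Prop) : Prop :=
  [/\ I 0, (forall p q, I p -> I q -> I (p + q)) & (forall a p, I p -> I (a * p))].

Definition RelGen (n s : nat) (p : A s) : Prop :=
  (exists i, (1 <= i <= s)%N /\ p = eA s i ^+ 2 - eA s (2 * i)%N) \/
  (exists i, (2 ^ n <= i <= s)%N /\ p = vA s * eA s i).

Definition Rel (n s : nat) : A s -> Prop := gen_ideal (RelGen n s).

(** Reduced coproduct data.  For an odd o with 1 <= o <= s:
    - o = <2k> = 2^n - 1 - 2k with 0 < k < 2^(n-1):
        ~Delta(e_o) = sum_{i=0}^{nu_2(k)} v^{i+1} e_{<k/2^i>} (x) e_{<k/2^i>}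
                        * prod_{j<i} (e_{<k/2^j>} (x) 1 + 1 (x) e_{<k/2^j>})
    - o = 2^n - 1 : ~Delta(e_o) = v e_o (x) e_o
    - o > 2^n - 1 : ~Delta(e_o) = 0. *)
Definition angle (n t : nat) : nat := (2 ^ n - 1 - t)%N.

Definition delta_odd (n s o : nat) : B s :=
  ex s o + ey s o +
  (if (o < 2 ^ n - 1)%N then
     let k := ((2 ^ n - 1 - o) %/ 2)%N in
     let E i := angle n (k %/ 2 ^ i) in
     \sum_(i < (logn 2 k).+1)
        vB s ^+ i.+1 * ex s (E i) * ey s (E i) *
        \prod_(j < i) (ex s (E j) + ey s (E j))
   else if o == (2 ^ n - 1)%N then vB s * ex s o * ey s o
   else 0).

(** Delta(e_j) for j = o * 2^c (o odd): Delta(e_o)^(2^c), since e_j = e_o^(2^c)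
    in H and Delta is multiplicative. *)
Definition delta_var (n s j : nat) : B s :=
  delta_odd n s (j %/ 2 ^ logn 2 j) ^+ (2 ^ logn 2 j).

Definition Delta (n s : nat) (p : A s) : B s :=
  p \mPo [tuple if (i : nat) == 0%N then vB s else delta_var n s (i : nat) | i < s.+1].

Definition incl_x (s : nat) (p : A s) : B s :=
  p \mPo [tuple if (i : nat) == 0%N then vB s else ex s (i : nat) | i < s.+1].
Definition incl_y (s : nat) (p : A s) : B s :=
  p \mPo [tuple if (i : nat) == 0%N then vB s else ey s (i : nat) | i < s.+1].

Definition counit (s : nat) (p : A s) : A s :=
  p \mPo [tuple if (i : nat) == 0%N then vA s else 0 | i < s.+1].

(** I (an ideal of A s containing Rel) defines a bi-ideal of H. *)
Definition bi_ideal (n s : nat) (I : A s -> Prop) : Prop :=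
  forall p, I p ->
    counit s p = 0 /\
    gen_ideal (fun q : B s => exists r, I r /\ (q = incl_x s r \/ q = incl_y s r))
              (Delta n s p).

Definition wdeg (n s : nat) (m : 'X_{1..s.+1}) : int :=
  \sum_(i < s.+1) (m i)%:Z * (if i == ord0 then 1 - (2 ^ n)%:Z else (i : nat)%:Z).

Definition hcomp (n s : nat) (d : int) (p : A s) : A s :=
  \sum_(m <- msupp p | wdeg n s m == d) p@_m *: 'X_[m].

Definition homogeneous (n s : nat) (I : A s -> Prop) : Prop :=
  forall p, I p -> forall d : int, I (hcomp n s d p).

Definition sOf (m : nat) : nat := (m.-1)./2.
Definition m0Of (n m : nat) : nat :=
  if (m <= 2 ^ n.+1)%N then m
  else if odd m then (2 ^ n.+1 - 1)%N else (2 ^ n.+1)%N.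

(** Restriction A s -> A s0 (pullback along SO_{m0} -> SO_m): e_i |-> e_i for
    i <= s0, e_i |-> 0 for i > s0, v |-> v. *)
Definition restr (s s0 : nat) (p : A s) : A s0 :=
  p \mPo [tuple if (i : nat) == 0%N then vA s0 else eA s0 (i : nat) | i < s.+1].

(** Preimage in A s0 of the image I_0 of I (in H_0 = A s0 / Rel n s0). *)
Definition image_ideal (n s s0 : nat) (I : A s -> Prop) (q : A s0) : Prop :=
  exists p, I p /\ Rel n s0 (q - restr s s0 p).

Definition saturated (s0 : nat) (N : A s0 -> Prop) : Prop :=
  forall q, N (vA s0 * q) -> N q.

(* Main.v *)
Require Import Defs.
From HB Require Import structures.
From Stdlib Require Import ClassicalEpsilon.
From mathcomp Require Import all_boot all_order all_algebra.
From mathcomp Require Import ssrcomplements mpoly zify ring.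
Set Implicit Arguments.
Unset Strict Implicit.
Unset Printing Implicit Defensive.
Import GRing.Theory.
Local Open Scope ring_scope.

(** Modulo the relations, H is spanned over F_2[v] by the squarefree monomials
    e_U = prod_(i in U) e_i, and modulo v the coproduct is
    e_S |-> sum_(U in S) e_U (x) e_(S - U). Let T be the set of the t with e_t in I + vH.

    Modulo v, the coefficients c_U with U disjoint from T vanish on I, by induction on the
    weight of U: if |U| >= 2, write U as the disjoint union of U1 and U2 and apply
    c_U1 (x) c_U2 to Delta(p); if U = {d}, a homogeneous p in I with c_U(p) <> 0 has no other
    term disjoint from T, whence d in T.

    The same induction with v specialised to 1 shows that no monomial v^k e_U with U in
    [1, 2^n - 1] disjoint from T occurs in I. Here Delta(e_S) also has terms of higher weight;
    they are harmless because T is stable under <2k> |-> <k>: otherwise e_<2k> = v y modulo I,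
    and the term v e_<k> (x) e_<k> of Delta(e_<2k>) would have to come from Delta(y), while
    the coefficient of e_<k> (x) e_<k> in Delta(y) is zero modulo v as y has degree 2<k>.
    For U = {d} the claim reduces to the previous one by dividing by v, which is the
    only use of saturation.

    It follows that e_t in I for every t in T, by descending induction on weights, and that
    I is generated by these e_t, which are powers of the e_o with o odd. *)

(** * Odd parts and binary digits of natural numbers *)

Section Binary.
Local Open Scope nat_scope.

Lemma odd_pow2_inj (o o' c c' : nat) :
  odd o -> odd o' -> (o * 2 ^ c = o' * 2 ^ c')%N -> o = o' /\ c = c'.
Proof.
elim: c c' => [|c IH] [|c'] oo oo'; rewrite ?expn0 ?expnS ?muln1.
- by move->.
- by move=> E; move: oo; rewrite E mulnCA oddM.
- by move=> E; move: oo'; rewrite -E mulnCA oddM.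
- rewrite mulnCA [in RHS]mulnCA => /eqP; rewrite eqn_pmul2l // => /eqP E.
  by have [-> ->] := IH _ oo oo' E.
Qed.

Lemma odd_pow2P (j : nat) : (0 < j)%N ->
  exists o c, odd o /\ j = (o * 2 ^ c)%N.
Proof.
have [k] := ubnP j; elim: k j => // k IH j le_jk j0.
have [oj|ej] := boolP (odd j); first by exists j, 0%N; rewrite expn0 muln1.
have [|//|o [c [oo E]]] := IH j./2; [lia|lia|].
exists o, c.+1; split=> //; rewrite expnS mulnCA -E mul2n.
by rewrite -[LHS]odd_double_half (negbTE ej).
Qed.

Lemma bits_lt (b : nat -> bool) K : (\sum_(c < K) b c * 2 ^ c < 2 ^ K)%N.
Proof.
elim: K => [|K IH]; first by rewrite big_ord0.
rewrite big_ord_recr /= expnS mul2n -addnn.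
by case: (b K); rewrite ?mul1n ?mul0n ?addn0 ?ltn_add2r // ltn_addl.
Qed.

Lemma bits_inj (b b' : nat -> bool) K :
  (\sum_(c < K) b c * 2 ^ c = \sum_(c < K) b' c * 2 ^ c)%N ->
  forall c, (c < K)%N -> b c = b' c.
Proof.
elim: K => [//|K IH]; rewrite !big_ord_recr /= => E c.
have h := bits_lt b K; have h' := bits_lt b' K.
have EK : b K = b' K.
  move: E h h'; case: (b K) (b' K) => [] []; rewrite ?mul1n ?mul0n ?addn0 //.
    by move=> E _; rewrite -E ltnNge leq_addl.
  by move=> -> ; rewrite ltnNge leq_addl.
rewrite ltnS leq_eqVlt => /orP[/eqP-> //|]; apply: IH.
by move: E; rewrite EK => /addIn.
Qed.

End Binary.

(** * Reduction to squarefree monomials, seen as carrying in base 2 *)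

Section Carry.
Local Open Scope nat_scope.
Variable s : nat.
Implicit Types (f g : nat -> nat) (U V : {set 'I_s.+1}).

(* [e^f = prod_o e_o ^ oexp f o] after substituting [e_(o 2^c) = e_o ^ (2^c)]. *)
Definition oexp f (o : nat) : nat :=
  \sum_(c < s.+1) (if (o * 2 ^ c <= s)%N then f (o * 2 ^ c)%N else 0%N) * 2 ^ c.

Definition indic U (j : nat) : nat := inord j \in U.

(* [reduces f U] : the monomial [e^f] equals the squarefree monomial [e_U] modulo the
   relations [e_i^2 = e_(2i)], by comparison of binary expansions. *)
Definition reduces f U : bool :=
  [forall o : 'I_s.+1, odd o ==> (oexp f o == oexp (indic U) o)].

Definition fwt f : nat := \sum_(j < s.+1) j * f j.
Definition swt U : nat := \sum_(i : 'I_s.+1 | i \in U) i.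
Definition posi : {set 'I_s.+1} := [set i : 'I_s.+1 | (0 < i)%N].

Lemma eq_oexp f g o : odd o ->
  (forall j, (0 < j <= s)%N -> f j = g j) -> oexp f o = oexp g o.
Proof.
move=> oo E; apply: eq_bigr => c _; case: ifP => // le; rewrite E // le andbT.
by rewrite muln_gt0 expn_gt0 andbT odd_gt0.
Qed.

Lemma eq_reduces f g U :
  (forall j, (0 < j <= s)%N -> f j = g j) -> reduces f U = reduces g U.
Proof.
move=> E; apply: eq_forallb => o; case oo: (odd o) => //=.
by rewrite (eq_oexp oo E).
Qed.

Lemma oexpD f g o : oexp (fun j => f j + g j)%N o = (oexp f o + oexp g o)%N.
Proof.
rewrite /oexp -big_split; apply: eq_bigr => c _ /=.
by case: ifP => // _; rewrite mulnDl.
Qed.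

Lemma oexp_double i o : odd o -> (i.*2 <= s)%N ->
  oexp (fun j => (j == i) * 2)%N o = oexp (fun j => j == i.*2)%N o.
Proof.
(* The two sums agree after shifting [c] by one: the last term on the left is out of range because
   [o * 2^s > s], and the first term on the right vanishes because [o] is odd. *)
move=> oo les; rewrite /oexp big_ord_recr [in RHS]big_ord_recl /=.
have -> : (o * 2 ^ s <= s)%N = false.
  apply/negbTE; rewrite -ltnNge (leq_trans (ltn_expl s (isT : (1 < 2)%N))) //.
  by rewrite leq_pmull // odd_gt0.
have -> : (o * 2 ^ 0 == i.*2) = false.
  by apply/negbTE/eqP; rewrite muln1 => E; move: oo; rewrite E odd_double.
rewrite mul0n addn0 (_ : (if _ then _ else _) = 0%N) ?mul0n ?add0n; last by case: ifP.
apply: eq_bigr => c _; rewrite /bump /= add1n expnS [(o * (2 * _))%N]mulnCA mul2n.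
rewrite (inj_eq double_inj); case: eqP => [->|_]; last by rewrite !if_same.
rewrite les ifT; last lia.
by rewrite mul1n mul1n.
Qed.

Lemma oexp_indic U o : oexp (indic U) o =
  (\sum_(c < s.+1) ((o * 2 ^ c <= s) && (inord (o * 2 ^ c) \in U)) * 2 ^ c)%N.
Proof. by apply: eq_bigr => c _; rewrite /indic; case: ifP. Qed.

Lemma exp_le_self o c : odd o -> (o * 2 ^ c <= s)%N -> (c < s.+1)%N.
Proof.
move=> oo le; rewrite ltnS ltnW // (leq_trans (ltn_expl c (isT : (1 < 2)%N))) //.
by rewrite (leq_trans _ le) // leq_pmull // odd_gt0.
Qed.

Lemma odd_le_self o c : (o * 2 ^ c <= s)%N -> (o < s.+1)%N.
Proof. by move=> le; rewrite ltnS (leq_trans _ le) // leq_pmulr // expn_gt0. Qed.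

Lemma reducesP f U : reduces f U ->
  forall o c, odd o -> (o * 2 ^ c <= s)%N -> oexp f o = oexp (indic U) o.
Proof.
move/forallP => h o c oo le.
by have := h (Ordinal (odd_le_self le)); rewrite /= oo => /eqP.
Qed.

(** Write [i = o * 2^c] with [o] odd. Then [oexp f o] is at least [2^(d+c)], so its binary
    expansion, whose digits record the elements of [U] with odd part [o], has a digit in position at
    least [d + c]. *)
Lemma reduces_carry f U i d : reduces f U -> (0 < i <= s)%N -> (2 ^ d <= f i)%N ->
  exists e, [/\ (d <= e)%N, (i * 2 ^ e <= s)%N & inord (i * 2 ^ e) \in U].
Proof.
move=> red /andP[i0 ile] fi.
have [o [c [oo Ei]]] := odd_pow2P i0.
have M := reducesP red oo (c := c); rewrite -Ei in M; move: (M ile) => {}M.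
have lo : (2 ^ (d + c) <= oexp f o)%N.
  have cs : (c < s.+1)%N by apply: (@exp_le_self o); rewrite -?Ei.
  rewrite /oexp (bigD1 (Ordinal cs)) //= -Ei ile expnD.
  by rewrite (leq_trans _ (leq_addr _ _)) // leq_mul2r fi orbT.
have [/existsP[c' /and3P[h1 h2 h3]]|] := boolP [exists c' : 'I_s.+1,
    [&& (d + c <= c')%N, (o * 2 ^ c' <= s)%N & inord (o * 2 ^ c') \in U]].
  have Ec : (i * 2 ^ (c' - c) = o * 2 ^ c')%N.
    by rewrite Ei -mulnA -expnD subnKC //; lia.
  by exists (c' - c)%N; rewrite Ec; split=> //; lia.
rewrite negb_exists => /forallP h; move: lo; rewrite leqNgt M oexp_indic.
(* If all digits lie below position [d + c], the sum is less than [2^(d+c)], a contradiction. The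
   digits [b] are cut off beyond [s], so that the ranges [s.+1] and [d + c] can be compared in
   either order. *)
pose b c' := [&& (c' < s.+1), (o * 2 ^ c' <= s) & (inord (o * 2 ^ c') \in U)]%N.
have -> : (\sum_(c' < s.+1) ((o * 2 ^ c' <= s) && (inord (o * 2 ^ c') \in U)) * 2 ^ c'
          = \sum_(c' < d + c) b c' * 2 ^ c')%N.
  rewrite -(big_mkord xpredT
    (fun c' => ((o * 2 ^ c' <= s) && (inord (o * 2 ^ c') \in U)) * 2 ^ c')%N).
  rewrite -(big_mkord xpredT (fun c' => b c' * 2 ^ c')%N).
  have [le|lt] := leqP (d + c) s.+1.
    rewrite (big_cat_nat _ le) //= [X in (_ + X)%N]big_nat_cond.
    rewrite [X in (_ + X)%N]big1 => [|c' /andP[/andP[h1 h2] _]].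
      rewrite addn0; apply: eq_big_nat => c' /andP[_ h1].
      by rewrite /b (leq_trans h1 le).
    by have := h (Ordinal h2); rewrite /= h1 /= => /negbTE->.
  rewrite (big_cat_nat _ (ltnW lt)) //= [X in _ = (_ + X)%N]big_nat_cond.
  rewrite [X in _ = (_ + X)%N]big1 => [|c' /andP[/andP[h1 h2] _]].
    by rewrite addn0; apply: eq_big_nat => c' /andP[_ h1]; rewrite /b h1.
  by rewrite /b ltnNge h1.
by rewrite bits_lt.
Qed.

Lemma reduces_indic U V : U \subset posi -> V \subset posi ->
  reduces (indic U) V = (U == V).
Proof.
move=> Up Vp; apply/idP/eqP => [red|->]; last first.
  by apply/forallP => o; rewrite eqxx implybT.
apply/setP => i; have [i0|/negP i0] := boolP (0 < i)%N; last first.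
  have [/(subsetP Up)|_] := boolP (i \in U); first by rewrite inE.
  by have [/(subsetP Vp)|_] := boolP (i \in V); first by rewrite inE.
have [o [c [oo Ei]]] := odd_pow2P i0.
have ile : (o * 2 ^ c <= s)%N by rewrite -Ei -ltnS.
have := reducesP red oo ile; rewrite !oexp_indic.
move/(@bits_inj (fun c => (o * 2 ^ c <= s)%N && (inord (o * 2 ^ c) \in U))
  (fun c => (o * 2 ^ c <= s)%N && (inord (o * 2 ^ c) \in V)))/(_ c (exp_le_self oo ile)).
by rewrite ile /= -Ei inord_val.
Qed.

(** Every positive [j] is [o * 2^c] for exactly one odd [o] and one [c], so the weight can be
    regrouped by odd parts. *)
Lemma fwt_oexp f : fwt f = (\sum_(o < s.+1 | odd o) o * oexp f o)%N.
Proof.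
have E (o : 'I_s.+1) : odd o -> (o * oexp f o =
    \sum_(c < s.+1) \sum_(j < s.+1 | j == (o * 2 ^ c)%N :> nat) j * f j)%N.
  move=> oo; rewrite /oexp big_distrr /=; apply: eq_bigr => c _.
  case: ifP => le; last first.
    rewrite mul0n muln0 big1 // => j /eqP Ej; move: (ltn_ord j).
    by rewrite Ej ltnS le.
  rewrite (eq_bigl (pred1 (Ordinal (le : (o * 2 ^ c < s.+1)%N)))).
    by rewrite big_pred1_eq /= mulnCA mulnC.
  by move=> j; rewrite /= -val_eqE.
rewrite (eq_bigr _ E) pair_big_dep /= (exchange_big_dep xpredT) //=.
apply: eq_bigr => j _; have [j0|] := posnP j.
  by rewrite j0 mul0n big1.
move=> j0; have [o [c [oo Ej]]] := odd_pow2P j0.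
have ile : (o * 2 ^ c <= s)%N by rewrite -Ej -ltnS.
rewrite (eq_bigl (pred1 (Ordinal (odd_le_self ile), Ordinal (exp_le_self oo ile)))).
  by rewrite big_pred1_eq.
move=> [o' c'] /=; rewrite andbT -!pair_eqE /pair_eq /= -!val_eqE /=; apply/andP/andP.
  by case=> oo' /eqP; rewrite Ej => /(odd_pow2_inj oo oo')[-> ->].
by case=> /eqP-> /eqP->; rewrite Ej.
Qed.

(** The relation [e_i^2 = e_(2i)] preserves weight. Degree arguments pass from exponent vectors to
    index sets through this fact. *)
Lemma reduces_wt f U : reduces f U -> fwt f = swt U.
Proof.
move=> red; have -> : swt U = fwt (indic U).
  rewrite /swt /fwt big_mkcond; apply: eq_bigr => i _; rewrite /indic inord_val.
  by case: ifP => _; rewrite ?muln1 ?muln0.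
rewrite !fwt_oexp; apply: eq_bigr => o oo; congr (_ * _)%N.
by apply: (reducesP red (c := 0%N)) => //; rewrite muln1 -ltnS.
Qed.

Lemma reduces_double f U i : (0 < i)%N -> (i.*2 <= s)%N ->
  reduces (fun j => f j + (j == i) * 2)%N U =
  reduces (fun j => f j + (j == i.*2))%N U.
Proof.
move=> i0 le; apply: eq_forallb => o; case oo: (odd o) => //=.
by rewrite !oexpD oexp_double.
Qed.

End Carry.

(** * Ideals and congruences modulo an ideal *)

Section Ideals.
Variable R : comNzRingType.
Implicit Types (I G : R -> Prop).

Lemma ideal0 I : is_ideal I -> I 0. Proof. by case. Qed.
Lemma idealD I p q : is_ideal I -> I p -> I q -> I (p + q).
Proof. by case=> _ + _; apply. Qed.
Lemma idealMl I a p : is_ideal I -> I p -> I (a * p).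
Proof. by case=> _ _; apply. Qed.
Lemma idealMr I a p : is_ideal I -> I p -> I (p * a).
Proof. by rewrite mulrC; apply: idealMl. Qed.
Lemma idealN I p : is_ideal I -> I p -> I (- p).
Proof. by move=> iI Ip; rewrite -mulN1r; apply: idealMl. Qed.
Lemma idealB I p q : is_ideal I -> I p -> I q -> I (p - q).
Proof. by move=> iI Ip Iq; apply: idealD => //; apply: idealN. Qed.
Lemma ideal_sum I (J : Type) (r : seq J) (P : pred J) (F : J -> R) :
  is_ideal I -> (forall j, P j -> I (F j)) -> I (\sum_(j <- r | P j) F j).
Proof. by move=> iI; apply: big_ind => [|p q]; [case: iI|apply: idealD]. Qed.

Lemma gen_ideal_ideal G : is_ideal (gen_ideal G).
Proof.
split; first by exists [::]; rewrite big_nil.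
- move=> p q [cp [Hp ->]] [cq [Hq ->]]; exists (cp ++ cq).
  by rewrite big_cat; split=> // c; rewrite mem_cat => /orP[/Hp|/Hq].
- move=> a p [cp [Hp ->]]; exists [seq (a * c.1, c.2) | c <- cp]; split.
    by move=> c /mapP[c' /Hp Gc ->].
  by rewrite big_map big_distrr /=; apply: eq_bigr => c _; rewrite mulrA.
Qed.

Lemma gen_ideal_mem G g : G g -> gen_ideal G g.
Proof.
move=> Gg; exists [:: (1, g)]; rewrite big_seq1 mul1r; split=> // c.
by rewrite inE => /eqP->.
Qed.

Lemma gen_ideal_min G I : is_ideal I -> (forall g, G g -> I g) ->
  forall p, gen_ideal G p -> I p.
Proof.
move=> iI GI p [cs [Hc ->]]; rewrite big_seq; apply: ideal_sum => // c /Hc Gc.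
by apply: idealMl => //; apply: GI.
Qed.

Lemma ideal_prod_congr I (J : eqType) (r : seq J) (F G : J -> R) : is_ideal I ->
  (forall j, j \in r -> I (F j - G j)) -> I (\prod_(j <- r) F j - \prod_(j <- r) G j).
Proof.
move=> iI; elim: r => [|j r IH] H; first by rewrite !big_nil subrr; case: iI.
rewrite !big_cons (_ : _ - _ = (F j - G j) * \prod_(j <- r) F j
  + G j * (\prod_(j <- r) F j - \prod_(j <- r) G j)); last by ring.
apply: idealD => //; first by apply: idealMr => //; apply: H; rewrite mem_head.
by apply: idealMl => //; apply: IH => k kr; apply: H; rewrite inE kr orbT.
Qed.

End Ideals.

(** * Linear functionals with prescribed values on monomials *)

HB.lock Definition lext (N : nat) (R : comNzRingType) (chi : 'X_{1..N} -> R)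
  (p : {mpoly R[N]}) : R := \sum_(m <- msupp p) p@_m * chi m.

Section LinearExtension.
Variables (N : nat) (R : comNzRingType).
Implicit Types (chi : 'X_{1..N} -> R) (p a : {mpoly R[N]}).

Lemma lextE chi p : lext chi p = \sum_(m <- msupp p) p@_m * chi m.
Proof. by rewrite unlock. Qed.

(** A common degree bound makes the index set independent of [p], so that sums for different
    polynomials can be added termwise. *)
Lemma lextwE chi k p : (msize p <= k)%N ->
  lext chi p = \sum_(m : 'X_{1..N < k}) p@_m * chi m.
Proof.
move=> le_pk; set T : subFinType _ := 'X_{1..N < k}.
rewrite lextE (big_mksub T) ?msupp_uniq //=; first last.
  by move=> x /msize_mdeg_lt /leq_trans; apply.
by rewrite big_rmcond //= => j /memN_msupp_eq0 ->; rewrite mul0r.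
Qed.

Lemma lext_is_additive chi : zmod_morphism (lext chi).
Proof.
move=> p q; pose k := maxn (msize (p - q)) (maxn (msize p) (msize q)).
rewrite !(@lextwE _ k) ?leq_max ?leqnn ?orbT // -sumrB.
by apply: eq_bigr => m _; rewrite mcoeffB mulrBl.
Qed.

HB.instance Definition _ chi :=
  GRing.isZmodMorphism.Build {mpoly R[N]} R (lext chi) (lext_is_additive chi).

Lemma lextZ chi c p : lext chi (c *: p) = c * lext chi p.
Proof.
pose k := maxn (msize (c *: p)) (msize p).
rewrite !(@lextwE _ k) ?leq_max ?leqnn ?orbT // big_distrr /=.
by apply: eq_bigr => m _; rewrite mcoeffZ mulrA.
Qed.

Lemma lextX chi m : lext chi 'X_[m] = chi m.
Proof. by rewrite lextE msuppX big_seq1 mcoeffX eqxx mul1r. Qed.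

Lemma eq_lext chi chi' p : (forall m, m \in msupp p -> chi m = chi' m) ->
  lext chi p = lext chi' p.
Proof. by move=> E; rewrite !lextE; apply: eq_big_seq => m /E->. Qed.

Lemma lextMX chi a m : lext chi (a * 'X_[m]) = lext (fun k => chi (k + m)%MM) a.
Proof.
rewrite {1}[a]mpolyE mulr_suml raddf_sum /= [RHS]lextE; apply: eq_bigr => k _.
by rewrite -scalerAl lextZ -mpolyXD lextX.
Qed.

Lemma lext_eq0 chi p : (forall m, m \in msupp p -> chi m = 0) -> lext chi p = 0.
Proof. by move=> E; rewrite lextE big1_seq // => m /andP[_ /E->]; rewrite mulr0. Qed.

Lemma lextB0 chi a (m m' : 'X_{1..N}) :
  (forall k, chi (k + m)%MM = chi (k + m')%MM) -> lext chi (a * ('X_[m] - 'X_[m'])) = 0.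
Proof. by move=> E; rewrite mulrBr raddfB /= !lextMX (eq_lext (fun k _ => E k)) subrr. Qed.

End LinearExtension.

(** * The variables of the polynomial rings *)

Section Vars.

Lemma mvarE N k (lt : (k < N)%N) : mvar N k = 'X_(Ordinal lt).
Proof. by rewrite /mvar insubT. Qed.

Lemma vAE s : vA s = 'X_(ord0 : 'I_s.+1).
Proof. by rewrite /vA mvarE; congr 'X_[mnm1 _]; apply: val_inj. Qed.

Lemma vBE s : vB s = 'X_(ord0 : 'I_(2 * s).+1).
Proof. by rewrite /vB mvarE; congr 'X_[mnm1 _]; apply: val_inj. Qed.

Lemma eAE s (i : 'I_s.+1) : (0 < i)%N -> eA s i = 'X_i.
Proof.
move=> i0; rewrite /eA i0 -ltnS ltn_ord /= mvarE; congr 'X_[mnm1 _].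
exact: val_inj.
Qed.

Lemma eA0 s j : (s < j)%N -> eA s j = 0.
Proof. by rewrite /eA ltnNge => /negbTE->; rewrite andbF. Qed.

Lemma ex0 s j : (s < j)%N -> ex s j = 0.
Proof. by rewrite /ex ltnNge => /negbTE->; rewrite andbF. Qed.

Lemma ey0 s j : (s < j)%N -> ey s j = 0.
Proof. by rewrite /ey ltnNge => /negbTE->; rewrite andbF. Qed.

Lemma exE s j : (0 < j <= s)%N -> ex s j = 'X_(inord j : 'I_(2 * s).+1).
Proof.
move=> h; rewrite /ex h mvarE; first lia.
move=> lt; congr 'X_[mnm1 _]; apply: val_inj; rewrite /= inordK //.
Qed.

Lemma eyE s j : (0 < j <= s)%N -> ey s j = 'X_(inord (s + j) : 'I_(2 * s).+1).
Proof.
move=> h; rewrite /ey h mvarE; first lia.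
move=> lt; congr 'X_[mnm1 _]; apply: val_inj; rewrite /= inordK //.
Qed.

Lemma mpoly_ind_ring N (R : comNzRingType) (P : {mpoly R[N]} -> Prop) :
  (forall c, P c%:MP) -> (forall i, P 'X_i) ->
  (forall p q, P p -> P q -> P (p + q)) -> (forall p q, P p -> P q -> P (p * q)) ->
  forall p, P p.
Proof.
move=> PC PX PD PM p; rewrite [p]mpolyE; apply: big_ind => //.
  by rewrite -(mpolyC0 N R).
move=> m _; rewrite -mul_mpolyC mpolyXE_id; apply: (PM) => //.
apply: big_ind => // [|i _]; first by rewrite -(mpolyC1 N R).
by elim: (m i) => [|k IH]; rewrite ?expr0 ?exprS -?(mpolyC1 N R) //; apply: PM.
Qed.

End Vars.

(** * Coefficient functionals on [H] and on [H (x) H] *)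

Section Functionals.
Variable s : nat.
Implicit Types (U V W Z : {set 'I_s.+1}) (phi : nat -> F2) (eps : F2).

(** Only the indices [0 < j <= s] are meaningful: [expA m 0] and [expX m 0] are exponents of [v],
    and for [s > 0] [expY m 0] is that of the last [x] variable. *)
Definition expA (m : 'X_{1..s.+1}) (j : nat) : nat := m (inord j).
Definition expX (m : 'X_{1..(2 * s).+1}) (j : nat) : nat := m (inord j).
Definition expY (m : 'X_{1..(2 * s).+1}) (j : nat) : nat := m (inord (s + j)).

Lemma expAD m k j : expA (m + k) j = (expA m j + expA k j)%N.
Proof. exact: mnmDE. Qed.
Lemma expXD m k j : expX (m + k) j = (expX m j + expX k j)%N.
Proof. exact: mnmDE. Qed.
Lemma expYD m k j : expY (m + k) j = (expY m j + expY k j)%N.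
Proof. exact: mnmDE. Qed.

(* For [phi = (_ == k)%:R] this is the coefficient of [v^k e_U]; for [phi = (eps ^+ _)]
   it is the coefficient of [e_U] after specialising [v] to [eps]. *)
Definition fA phi U : A s -> F2 :=
  lext (fun m => phi (m ord0) * (reduces (expA m) U)%:R).

Definition fB eps U W : B s -> F2 :=
  lext (fun m => eps ^+ m ord0 * (reduces (expX m) U)%:R * (reduces (expY m) W)%:R).

HB.instance Definition _ phi U := GRing.Additive.on (fA phi U).
HB.instance Definition _ eps U W := GRing.Additive.on (fB eps U W).

(* The common kernel of the functionals supported on [V]: this is the ideal of relations
   of [H (x) H], with [v] specialised to [eps] and the [e_i], [i \notin V], set to 0. *)
Definition kerB eps V (b : B s) : Prop :=
  forall U W, U \subset V -> W \subset V -> forall a, fB eps U W (a * b) = 0.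

Lemma kerB_ideal eps V : is_ideal (kerB eps V).
Proof.
split=> [U W _ _ a|p q Kp Kq U W UV WV a|c p Kp U W UV WV a].
- by rewrite mulr0 raddf0.
- by rewrite mulrDr raddfD /= Kp // Kq // addr0.
- by rewrite mulrA Kp.
Qed.

Lemma reduces_twice (f g h : nat -> nat) U (i : nat) : (0 < i)%N -> (i.*2 <= s)%N ->
  (forall j, (0 < j <= s)%N -> g j = f j + (j == i) * 2)%N ->
  (forall j, (0 < j <= s)%N -> h j = f j + (j == i.*2))%N ->
  reduces g U = reduces h U.
Proof.
by move=> i0 le gE hE; rewrite (eq_reduces U gE) (eq_reduces U hE) reduces_double.
Qed.

(** Carrying from position [i] would produce an element [i * 2^e] with [e > 0], which exceeds [s].
    This is the relation [e_i^2 = 0] for [2i > s]. *)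
Lemma reduces_overflow (g : nat -> nat) U (i : nat) : (0 < i <= s)%N -> (s < i.*2)%N ->
  (2 <= g i)%N -> reduces g U = false.
Proof.
move=> ile lt gi; apply/negP => red.
have [//|[|e] [// _ le _]] := reduces_carry (d := 1) red ile.
move: le; rewrite leqNgt (leq_trans lt) //.
by rewrite -muln2 leq_mul2l expnS leq_pmulr ?orbT // expn_gt0.
Qed.

(** The indices outside [V] are then stable under doubling, so setting these [e_i] to 0 is
    compatible with [e_i^2 = e_(2i)] and kills no [e_U] with [U] inside [V]. *)
Definition downclosed V := forall i : nat, (0 < i)%N -> (i.*2 <= s)%N ->
  (inord i.*2 : 'I_s.+1) \in V -> (inord i : 'I_s.+1) \in V.

Lemma downclosed_out V U i e : downclosed V -> U \subset V -> (0 < i)%N ->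
  (inord i : 'I_s.+1) \notin V -> (i * 2 ^ e <= s)%N -> (inord (i * 2 ^ e) : 'I_s.+1) \notin U.
Proof.
move=> dV UV i0 iV le; apply: contra iV => /(subsetP UV).
elim: e le => [|e IH]; first by rewrite muln1.
rewrite expnS mulnCA mul2n => le /dV; rewrite muln_gt0 i0 expn_gt0 => /(_ isT le) h.
by apply: IH => //; lia.
Qed.

Lemma reduces_out V U (g : nat -> nat) i : downclosed V -> U \subset V ->
  (0 < i <= s)%N -> (inord i : 'I_s.+1) \notin V -> (0 < g i)%N -> reduces g U = false.
Proof.
move=> dV UV ile iV gi; apply/negP => red.
have [//|e [_ le h]] := reduces_carry (d := 0) red ile.
have i0 : (0 < i)%N by case/andP: ile.
by have := downclosed_out dV UV i0 iV le; rewrite h.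
Qed.

Lemma inord_eq N (i j : nat) : (i < N.+1)%N -> (j < N.+1)%N ->
  (inord i == inord j :> 'I_N.+1) = (i == j).
Proof. by move=> hi hj; rewrite -val_eqE /= !inordK. Qed.

Lemma inord_eq0 N (i : nat) : (0 < i)%N -> (i < N.+1)%N ->
  (inord i == ord0 :> 'I_N.+1) = false.
Proof. by move=> i0 hi; rewrite -val_eqE /= inordK // eqn0Ngt i0. Qed.

Lemma eAEn i : (0 < i <= s)%N -> eA s i = 'X_(inord i : 'I_s.+1).
Proof. by move=> /andP[i0 ile]; rewrite -eAE inordK. Qed.

Lemma fA_sq phi U a (i : nat) : (0 < i <= s)%N ->
  fA phi U (a * (eA s i ^+ 2 - eA s (2 * i))) = 0.
Proof.
move=> ile; rewrite mul2n eAEn // mpolyXn; have [le|lt] := leqP i.*2 s.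
  rewrite eAEn; last by lia.
  rewrite [fA _ _ _]lextB0 // => k; congr (phi _ * _%:R).
    by rewrite mnmDE mulmnE mnmDE !mnm1E !inord_eq0 //; lia.
  congr nat_of_bool; apply: (@reduces_twice (expA k) _ _ _ i) => //; first by lia.
    by move=> j jle; rewrite /expA mnmDE mulmnE mnm1E inord_eq 1?eq_sym //; lia.
  by move=> j jle; rewrite /expA mnmDE mnm1E inord_eq 1?eq_sym //; lia.
rewrite eA0 // subr0 [fA _ _ _]lextMX lext_eq0 // => k _.
rewrite (@reduces_overflow _ _ i) ?mulr0 // /expA mnmDE mulmnE mnm1E eqxx; lia.
Qed.

Lemma fA_out phi V U a (i : nat) : downclosed V -> U \subset V ->
  (0 < i <= s)%N -> (inord i : 'I_s.+1) \notin V -> fA phi U (a * eA s i) = 0.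
Proof.
move=> dV UV ile iV; rewrite eAEn // [fA _ _ _]lextMX lext_eq0 // => k _.
by rewrite (reduces_out dV UV ile iV) ?mulr0 // /expA mnmDE mnm1E eqxx addn1.
Qed.

Lemma fA_v phi U p : fA phi U (vA s * p) = fA (fun k => phi k.+1) U p.
Proof.
rewrite mulrC vAE [LHS]lextMX; apply: eq_lext => m _.
congr (phi _ * _%:R); first by rewrite mnmDE mnm1E eqxx addn1.
congr nat_of_bool; apply: eq_reduces => j jle.
by rewrite /expA mnmDE mnm1E eq_sym inord_eq0 ?addn0 //; lia.
Qed.

Lemma kerB_v eps V : kerB eps V (vB s - eps%:MP).
Proof.
move=> U W _ _ a; rewrite mulrBr raddfB /= [a * _%:MP]mulrC mul_mpolyC.
rewrite [fB _ _ _ (_ *: _)]lextZ vBE [fB _ _ _ (_ * _)]lextMX; apply/eqP.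
rewrite subr_eq0; apply/eqP; rewrite /fB !lextE big_distrr /=; apply: eq_bigr => m _.
rewrite mnmDE mnm1E eqxx addn1 exprS.
rewrite (@eq_reduces _ (expX _) (expX m)); last first.
  by move=> j jle; rewrite /expX mnmDE mnm1E eq_sym inord_eq0 ?addn0 //; lia.
rewrite (@eq_reduces _ (expY _) (expY m)); last first.
  by move=> j jle; rewrite /expY mnmDE mnm1E eq_sym inord_eq0 ?addn0 //; lia.
by rewrite -!mulrA mulrCA.
Qed.

Lemma kerB_sqx eps V (i : nat) : (0 < i)%N -> kerB eps V (ex s i ^+ 2 - ex s i.*2).
Proof.
move=> i0 U W _ _ a; have [ile|lt] := leqP i s; last first.
  by rewrite !ex0 ?expr0n ?subrr ?mulr0 ?raddf0 //; lia.
have il : (0 < i <= s)%N by rewrite i0.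
rewrite exE // mpolyXn; have [le|lt] := leqP i.*2 s.
  rewrite exE; last by lia.
  rewrite [fB _ _ _ _]lextB0 // => k; congr (_ ^+ _ * _%:R * _%:R).
  - by rewrite mnmDE mulmnE mnmDE !mnm1E !inord_eq0 //; lia.
  - congr nat_of_bool; apply: (@reduces_twice (expX k) _ _ _ i) => //.
      by move=> j jle; rewrite /expX mnmDE mulmnE mnm1E inord_eq 1?eq_sym //; lia.
    by move=> j jle; rewrite /expX mnmDE mnm1E inord_eq 1?eq_sym //; lia.
  - congr nat_of_bool; apply: eq_reduces => j jle.
    by rewrite /expY mnmDE mulmnE mnmDE !mnm1E !inord_eq //; lia.
rewrite ex0 // subr0 [fB _ _ _ _]lextMX lext_eq0 // => k _.
rewrite (@reduces_overflow (expX _) _ i) ?mulr0 ?mul0r // /expX mnmDE mulmnE mnm1E eqxx; lia.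
Qed.

Lemma kerB_sqy eps V (i : nat) : (0 < i)%N -> kerB eps V (ey s i ^+ 2 - ey s i.*2).
Proof.
move=> i0 U W _ _ a; have [ile|lt] := leqP i s; last first.
  by rewrite !ey0 ?expr0n ?subrr ?mulr0 ?raddf0 //; lia.
have il : (0 < i <= s)%N by rewrite i0.
rewrite eyE // mpolyXn; have [le|lt] := leqP i.*2 s.
  rewrite eyE; last by lia.
  rewrite [fB _ _ _ _]lextB0 // => k; congr (_ ^+ _ * _%:R * _%:R).
  - by rewrite mnmDE mulmnE mnmDE !mnm1E !inord_eq0 //; lia.
  - congr nat_of_bool; apply: eq_reduces => j jle.
    by rewrite /expX mnmDE mulmnE mnmDE !mnm1E !inord_eq //; lia.
  - congr nat_of_bool; apply: (@reduces_twice (expY k) _ _ _ i) => //.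
      by move=> j jle; rewrite /expY mnmDE mulmnE mnm1E inord_eq; lia.
    by move=> j jle; rewrite /expY mnmDE mnm1E inord_eq; lia.
rewrite ey0 // subr0 [fB _ _ _ _]lextMX lext_eq0 // => k _.
rewrite (@reduces_overflow (expY _) _ i) ?mulr0 ?mul0r // /expY mnmDE mulmnE mnm1E eqxx; lia.
Qed.

Lemma kerB_outx eps V (i : nat) : downclosed V -> (0 < i)%N ->
  ((i <= s)%N -> (inord i : 'I_s.+1) \notin V) -> kerB eps V (ex s i).
Proof.
move=> dV i0 iV U W UV _ a; have [ile|lt] := leqP i s; last by rewrite ex0 // mulr0 raddf0.
have il : (0 < i <= s)%N by rewrite i0.
rewrite exE // [fB _ _ _ _]lextMX lext_eq0 // => k _.
by rewrite (reduces_out dV UV il (iV ile)) ?mulr0 ?mul0r // /expX mnmDE mnm1E eqxx addn1.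
Qed.

Lemma kerB_outy eps V (i : nat) : downclosed V -> (0 < i)%N ->
  ((i <= s)%N -> (inord i : 'I_s.+1) \notin V) -> kerB eps V (ey s i).
Proof.
move=> dV i0 iV U W _ WV a; have [ile|lt] := leqP i s; last by rewrite ey0 // mulr0 raddf0.
have il : (0 < i <= s)%N by rewrite i0.
rewrite eyE // [fB _ _ _ _]lextMX lext_eq0 // => k _.
by rewrite (reduces_out dV WV il (iV ile)) ?mulr0 ?mul0r // /expY mnmDE mnm1E eqxx addn1.
Qed.

Definition monX Z : B s := \prod_(i in Z) ex s i.
Definition monY Z : B s := \prod_(i in Z) ey s i.

(** The functionals are dual to the products [e_Z (x) e_Z'], because a squarefree monomial reduces
    only to itself. *)
Lemma fB_mon eps U W Z Z' : U \subset posi s -> W \subset posi s ->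
  Z \subset posi s -> Z' \subset posi s ->
  fB eps U W (monX Z * monY Z') = ((Z == U) && (Z' == W))%:R.
Proof.
move=> Up Wp Zp Zp'.
have xE (i : 'I_s.+1) : i \in Z -> ex s i = 'X_(inord i : 'I_(2 * s).+1).
  by move/(subsetP Zp); rewrite inE => i0; rewrite exE // i0 -ltnS ltn_ord.
have yE (i : 'I_s.+1) : i \in Z' -> ey s i = 'X_(inord (s + i) : 'I_(2 * s).+1).
  by move/(subsetP Zp'); rewrite inE => i0; rewrite eyE // i0 -ltnS ltn_ord.
rewrite /monX /monY (eq_bigr _ xE) (eq_bigr _ yE) !mprodXE -mpolyXD [fB _ _ _ _]lextX.
set m := (_ + _)%MM.
have mx j : (0 < j <= s)%N -> expX m j = indic Z j.
  move=> jle; rewrite /expX /m mnmDE !mnm_sumE /= [X in (_ + X)%N]big1 => [|i iZ]; last first.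
    rewrite mnm1E inord_eq; [|by move: (ltn_ord i); lia|by lia].
    by move/(subsetP Zp'): iZ; rewrite inE; lia.
  rewrite addn0 /indic big_mkcond (bigD1 (inord j)) //= mnm1E inordK; last by lia.
  rewrite eqxx [X in (_ + X)%N]big1 ?addn0; first by case: (_ \in _).
  move=> i ij; case: ifP => // _; rewrite mnm1E inord_eq; [|by move: (ltn_ord i); lia|by lia].
  apply/eqP; rewrite eqb0; apply: contra ij => /eqP<-; by rewrite inord_val.
have my j : (0 < j <= s)%N -> expY m j = indic Z' j.
  move=> jle; rewrite /expY /m mnmDE !mnm_sumE /= [X in (X + _)%N]big1 => [|i iZ]; last first.
    rewrite mnm1E inord_eq; [|by move: (ltn_ord i); lia|by lia].
    by move: (ltn_ord i); lia.
  rewrite add0n /indic big_mkcond (bigD1 (inord j)) //= mnm1E inordK; last by lia.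
  rewrite eqxx [X in (_ + X)%N]big1 ?addn0; first by case: (_ \in _).
  move=> i ij; case: ifP => // _; rewrite mnm1E inord_eq; [|by move: (ltn_ord i); lia|by lia].
  apply/eqP; rewrite eqb0 eqn_add2l; apply: contra ij => /eqP<-; by rewrite inord_val.
have -> : m ord0 = 0%N.
  rewrite /m mnmDE !mnm_sumE !big1 // => i iZ; rewrite mnm1E inord_eq0 //;
    by [move/(subsetP Zp): (iZ); move/(subsetP Zp'): (iZ); rewrite !inE; move: (ltn_ord i); lia
       |move: (ltn_ord i); lia
       |move/(subsetP Zp): iZ; rewrite inE
       |move/(subsetP Zp'): iZ; rewrite inE; lia].
rewrite mul1r (eq_reduces U mx) (eq_reduces W my) !reduces_indic //.
by case: (_ == _) (_ == _) => [] []; rewrite ?mulr0 ?mul0r ?mulr1.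
Qed.

(** A filtration by total weight in the [e_i] alone: [v] has weight 0 here, unlike in the grading of
    [H]. *)
Definition filt (d : nat) (b : B s) : Prop :=
  forall m, m \in msupp b -> (d <= fwt s (expX m) + fwt s (expY m))%N.

Lemma fwtD (f g : nat -> nat) : fwt s (fun j => f j + g j)%N = (fwt s f + fwt s g)%N.
Proof. by rewrite /fwt -big_split; apply: eq_bigr => i _; rewrite mulnDr. Qed.

Lemma eq_fwt (f g : nat -> nat) : (forall j, (0 < j <= s)%N -> f j = g j) -> fwt s f = fwt s g.
Proof.
move=> E; apply: eq_bigr => -[[|j] lt] _ //=; by rewrite E // -ltnS lt.
Qed.

(** Reduction preserves weight in each factor, so the functional only sees monomials of total weight
    [swt U + swt W]. *)
Lemma fB_filt eps U W d b : filt d b -> (swt U + swt W < d)%N -> fB eps U W b = 0.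
Proof.
move=> fb lt; apply: lext_eq0 => m /fb; apply: contraTeq => nz.
rewrite -ltnNge; move: nz.
case: (boolP (reduces (expX m) U)) => [/reduces_wt->|_]; last by rewrite mulr0 mul0r eqxx.
by case: (boolP (reduces (expY m) W)) => [/reduces_wt->|_] //; rewrite mulr0 eqxx.
Qed.

Lemma filt0 d : filt d 0. Proof. by move=> m; rewrite msupp0. Qed.

Lemma filtW d d' b : (d' <= d)%N -> filt d b -> filt d' b.
Proof. by move=> le fb m /fb; apply: leq_trans. Qed.

Lemma filtD d b c : filt d b -> filt d c -> filt d (b + c).
Proof. by move=> fb fc m /msuppD_le; rewrite mem_cat => /orP[/fb|/fc]. Qed.

Lemma filtM d d' b c : filt d b -> filt d' c -> filt (d + d') (b * c).
Proof.
move=> fb fc m /msuppM_le/allpairsP[[m1 m2] /= [/fb h1 /fc h2 ->]].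
rewrite (@eq_fwt (expX _) (fun j => expX m1 j + expX m2 j)%N); last first.
  by move=> j _; rewrite /expX mnmDE.
rewrite (@eq_fwt (expY _) (fun j => expY m1 j + expY m2 j)%N); last first.
  by move=> j _; rewrite /expY mnmDE.
by rewrite !fwtD addnACA leq_add.
Qed.

Lemma filt_any b : filt 0 b. Proof. by []. Qed.

Lemma fwt_ge (f : nat -> nat) (j : nat) : (0 < j <= s)%N -> (0 < f j)%N -> (j <= fwt s f)%N.
Proof.
case/andP=> j0 jle fj; rewrite /fwt (bigD1 (Ordinal (jle : (j < s.+1)%N))) //=.
by rewrite (leq_trans _ (leq_addr _ _)) // leq_pmulr.
Qed.

Lemma filt_x j : filt j (ex s j).
Proof.
have [h|h] := boolP (0 < j <= s)%N; last by rewrite /ex (negbTE h); apply: filt0.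
rewrite exE // => m; rewrite msuppX inE => /eqP->.
by rewrite (leq_trans _ (leq_addr _ _)) // fwt_ge // /expX mnm1E eqxx.
Qed.

Lemma filt_y j : filt j (ey s j).
Proof.
have [h|h] := boolP (0 < j <= s)%N; last by rewrite /ey (negbTE h); apply: filt0.
rewrite eyE // => m; rewrite msuppX inE => /eqP->.
by rewrite (leq_trans _ (leq_addl _ _)) // fwt_ge // /expY mnm1E eqxx.
Qed.

Definition liftX (m : 'X_{1..s.+1}) : 'X_{1..(2 * s).+1} :=
  (\sum_(i < s.+1) U_(inord i) *+ m i)%MM.
Definition liftY (m : 'X_{1..s.+1}) : 'X_{1..(2 * s).+1} :=
  (\sum_(i < s.+1) U_(if i == 0%N :> nat then ord0 else inord (s + i)) *+ m i)%MM.

Lemma incl_xX m : incl_x s 'X_[m] = 'X_[liftX m].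
Proof.
rewrite /incl_x comp_mpolyX /liftX -mprodXnE; apply: eq_bigr => i _.
rewrite tnth_mktuple; case: eqP => [E|/eqP i0].
  by rewrite vBE; congr ('X_[mnm1 _] ^+ _); apply: val_inj; rewrite /= E inordK.
by rewrite exE // lt0n i0 -ltnS ltn_ord.
Qed.

Lemma incl_yX m : incl_y s 'X_[m] = 'X_[liftY m].
Proof.
rewrite /incl_y comp_mpolyX /liftY -mprodXnE; apply: eq_bigr => i _.
rewrite tnth_mktuple; case: eqP => [E|/eqP i0]; first by rewrite vBE.
by rewrite eyE // lt0n i0 -ltnS ltn_ord.
Qed.

Lemma sum_pick (m : 'X_{1..s.+1}) (j : 'I_s.+1) (P : 'I_s.+1 -> bool) :
  (forall i, P i = (i == j)) -> (\sum_(i < s.+1) P i * m i)%N = m j.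
Proof.
move=> E; rewrite (bigD1 j) //= E eqxx mul1n big1 ?addn0 // => i.
by rewrite E => /negbTE->.
Qed.

Lemma liftX0 m : liftX m ord0 = m ord0.
Proof.
rewrite /liftX mnm_sumE -[RHS](@sum_pick _ _ (pred1 ord0)) //.
apply: eq_bigr => i _; rewrite mulmnE mnm1E -!val_eqE /= inordK //.
by move: (ltn_ord i); lia.
Qed.

Lemma liftY0 m : liftY m ord0 = m ord0.
Proof.
rewrite /liftY mnm_sumE -[RHS](@sum_pick _ _ (pred1 ord0)) //.
apply: eq_bigr => i _; rewrite mulmnE mnm1E; case: (altP (i =P 0%N :> nat)) => [E|i0].
  by rewrite (_ : i = ord0) /= ?eqxx //; apply: val_inj.
rewrite inord_eq0; [|by move: (ltn_ord i); lia|by move: (ltn_ord i); lia].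
by rewrite /= -val_eqE /= (negbTE i0).
Qed.

Lemma expX_liftX m j : (0 < j <= s)%N -> expX (liftX m) j = expA m j.
Proof.
move=> jle; rewrite /expX /liftX mnm_sumE -[RHS](@sum_pick _ _ (pred1 (inord j))) //.
apply: eq_bigr => i _; rewrite mulmnE mnm1E /= -[i == _]val_eqE /= inordK; last by lia.
by rewrite inord_eq //; move: (ltn_ord i); lia.
Qed.

Lemma expY_liftX m j : (0 < j <= s)%N -> expY (liftX m) j = 0%N.
Proof.
move=> jle; rewrite /expY /liftX mnm_sumE big1 // => i _.
rewrite mulmnE mnm1E -val_eqE /= !inordK; by move: (ltn_ord i); lia.
Qed.

Lemma expX_liftY m j : (0 < j <= s)%N -> expX (liftY m) j = 0%N.
Proof.
move=> jle; rewrite /expX /liftY mnm_sumE big1 // => i _.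
rewrite mulmnE mnm1E -val_eqE /=; case: (altP (i =P 0%N :> nat)) => [E|i0];
  rewrite /= !inordK; by move: (ltn_ord i); lia.
Qed.

Lemma expY_liftY m j : (0 < j <= s)%N -> expY (liftY m) j = expA m j.
Proof.
move=> jle; rewrite /expY /liftY mnm_sumE -[RHS](@sum_pick _ _ (pred1 (inord j))) //.
apply: eq_bigr => i _; rewrite mulmnE mnm1E /= -[i == inord j]val_eqE /= inordK; last by lia.
case: (altP (i =P 0%N :> nat)) => [E|i0].
  by rewrite eq_sym inord_eq0; lia.
by rewrite inord_eq ?eqn_add2l //; move: (ltn_ord i); lia.
Qed.

(** Both projections keep the whole exponent of [v], which is shared by the two tensor factors. *)
Definition projX (k : 'X_{1..(2 * s).+1}) : 'X_{1..s.+1} := [multinom k (inord i) | i < s.+1].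
Definition projY (k : 'X_{1..(2 * s).+1}) : 'X_{1..s.+1} :=
  [multinom (if i == 0%N :> nat then k ord0 else k (inord (s + i))) | i < s.+1].

Lemma expA_projX k j : (0 < j <= s)%N -> expA (projX k) j = expX k j.
Proof. by move=> jle; rewrite /expA mnmE inordK //; lia. Qed.

Lemma expA_projY k j : (0 < j <= s)%N -> expA (projY k) j = expY k j.
Proof. by move=> jle; rewrite /expA mnmE inordK; [case: eqP => //; lia|lia]. Qed.

Lemma projX0 k : projX k ord0 = k ord0.
Proof. by rewrite mnmE; congr (k _); apply: val_inj; rewrite /= inordK. Qed.

Lemma projY0 k : projY k ord0 = k ord0.
Proof. by rewrite mnmE. Qed.

(** On a monomial multiple of [r (x) 1] the second factor contributes only a scalar; the first
    factor and the power of [v] are absorbed into a multiplier of [r]. Hence the hypothesis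
    quantifies over all multiples of [r]. *)
Lemma fB_incl_x eps U W r : (forall a, fA (fun k => eps ^+ k) U (a * r) = 0) ->
  forall b, fB eps U W (b * incl_x s r) = 0.
Proof.
move=> Kr b; rewrite [b]mpolyE mulr_suml raddf_sum big1 //= => k _.
rewrite -scalerAl [fB _ _ _ _]lextZ -[X in _ * X]/(fB eps U W _).
suff -> : fB eps U W ('X_[k] * incl_x s r) =
    (reduces (expY k) W)%:R * fA (fun k => eps ^+ k) U ('X_[projX k] * r).
  by rewrite Kr !mulr0.
rewrite [r in incl_x s r]mpolyE [r in fA _ _ (_ * r)]mpolyE /incl_x raddf_sum /=.
rewrite !mulr_sumr [fB _ _ _ _]raddf_sum [fA _ _ _]raddf_sum /= mulr_sumr.
apply: eq_bigr => m _; rewrite comp_mpolyZ -!scalerAr.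
rewrite [fB _ _ _ _]lextZ [fA _ _ _]lextZ [RHS]mulrCA; congr (_ * _).
rewrite -/(incl_x s _) incl_xX -!mpolyXD !lextX !mnmDE liftX0 projX0.
rewrite mulrC; congr (_%:R * (_ * _%:R)); congr nat_of_bool; apply: eq_reduces => j jle.
  by rewrite expYD expY_liftX // addn0.
by rewrite expXD expAD expX_liftX // expA_projX.
Qed.

Lemma fB_incl_y eps U W r : (forall a, fA (fun k => eps ^+ k) W (a * r) = 0) ->
  forall b, fB eps U W (b * incl_y s r) = 0.
Proof.
move=> Kr b; rewrite [b]mpolyE mulr_suml raddf_sum big1 //= => k _.
rewrite -scalerAl [fB _ _ _ _]lextZ -[X in _ * X]/(fB eps U W _).
suff -> : fB eps U W ('X_[k] * incl_y s r) =
    (reduces (expX k) U)%:R * fA (fun k => eps ^+ k) W ('X_[projY k] * r).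
  by rewrite Kr !mulr0.
rewrite [r in incl_y s r]mpolyE [r in fA _ _ (_ * r)]mpolyE /incl_y raddf_sum /=.
rewrite !mulr_sumr [fB _ _ _ _]raddf_sum [fA _ _ _]raddf_sum /= mulr_sumr.
apply: eq_bigr => m _; rewrite comp_mpolyZ -!scalerAr.
rewrite [fB _ _ _ _]lextZ [fA _ _ _]lextZ [RHS]mulrCA; congr (_ * _).
rewrite -/(incl_y s _) incl_yX -!mpolyXD !lextX !mnmDE liftY0 projY0.
rewrite -mulrA mulrCA; congr (_%:R * (_ * _%:R)); congr nat_of_bool; apply: eq_reduces => j jle.
  by rewrite expXD expX_liftY // addn0.
by rewrite expYD expAD expY_liftY // expA_projY.
Qed.

End Functionals.

(** * Normal forms as combinations of the [v^k e_U] *)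

Section NormalForm.
Variable s : nat.
Implicit Types (U V W S : {set 'I_s.+1}) (p q : A s).

Definition eS U : A s := \prod_(i in U) 'X_i.

Definition coef (k : nat) U : A s -> F2 := fA (fun j => (j == k)%:R) U.

HB.instance Definition _ k U := GRing.Additive.on (coef k U).

(** Replacing a factor [e_i^2] by [e_(2i)] lowers the total degree by one, whence an induction. A
    squarefree monomial that leaves [V] lies in [G]; one inside [V] is the only term of the sum. *)
Lemma normal_form_mon (G : A s -> Prop) V : is_ideal G -> V \subset posi s ->
  (forall i, (0 < i <= s)%N -> G (eA s i ^+ 2 - eA s (2 * i))) ->
  (forall i : 'I_s.+1, (0 < i)%N -> i \notin V -> G 'X_i) ->
  forall m, G ('X_[m] - \sum_(U : {set 'I_s.+1} | U \subset V)
                 (reduces (expA m) U)%:R *: (vA s ^+ m ord0 * eS U)).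
Proof.
move=> iG Vp Gsq Gout m; have [d] := ubnP (mdeg m).
elim: d m => // d IH m lt_d.
have [/existsP[i /andP[i0 mi]]|] := boolP [exists i : 'I_s.+1, (0 < i)%N && (2 <= m i)%N].
  have ile : (0 < i <= s)%N by rewrite i0 -ltnS ltn_ord.
  pose m' := (m - U_(i) *+ 2)%MM.
  have mE : m = (m' + U_(i) *+ 2)%MM.
    rewrite /m' submK //; apply/mnm_lepP => j; rewrite mulmnE mnm1E.
    by case: eqP => [<-|].
  have XE : 'X_[m] = 'X_[m'] * eA s i ^+ 2 by rewrite mE mpolyXD -mpolyXn eAE.
  have [le|lt] := leqP i.*2 s; last first.
    rewrite big1 ?subr0 => [|U _]; last first.
      rewrite (@reduces_overflow _ _ _ i) ?scale0r // /expA inord_val //.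
    rewrite XE -[eA s i ^+ 2]subr0 -[0](@eA0 s (2 * i)) ?mul2n // -mul2n.
    by apply: idealMl => //; apply: Gsq.
  pose m2 := (m' + U_(inord i.*2))%MM.
  have -> : 'X_[m] = 'X_[m'] * (eA s i ^+ 2 - eA s (2 * i)) + 'X_[m2].
    by rewrite XE mulrBr mul2n /m2 mpolyXD [eA s i.*2]eAEn ?subrK //; lia.
  rewrite -addrA; apply: idealD => //; first by apply: idealMl => //; apply: Gsq.
  have -> : m ord0 = m2 ord0.
    rewrite mE /m2 mnmDE mulmnE mnmDE !mnm1E inord_eq0; [|lia|lia].
    by rewrite -val_eqE /= eqn0Ngt i0.
  rewrite (eq_bigr (fun U => (reduces (expA m2) U)%:R *: (vA s ^+ m2 ord0 * eS U))).
    apply: IH; move: lt_d; rewrite mE /m2 mdegD mdegMn mdegD !mdeg1; lia.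
  move=> U _; congr (_%:R *: _); congr nat_of_bool.
  apply: (@reduces_twice _ (expA m') _ _ _ i) => // j jle.
    by rewrite mE /expA mnmDE mulmnE mnm1E -[i]inord_val inord_eq ?inord_val 1?eq_sym //; lia.
  by rewrite /m2 /expA mnmDE mnm1E inord_eq 1?eq_sym //; lia.
(* From here on every [e_i] has exponent at most 1, and [S] is the set of those that occur. *)
rewrite negb_exists => /forallP sqf.
pose S := [set i : 'I_s.+1 | (0 < i)%N && (m i == 1%N)].
have Sp : S \subset posi s by apply/subsetP => i; rewrite !inE => /andP[].
have mS (i : 'I_s.+1) : (0 < i)%N -> m i = (i \in S).
  move=> i0; have := sqf i; rewrite inE i0 /= -ltnNge ltnS.
  by case: (m i) => [|[]].
have XE : 'X_[m] = vA s ^+ m ord0 * eS S.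
  rewrite mpolyXE_id (bigD1 ord0) //= -vAE; congr (_ * _).
  rewrite /eS [RHS]big_mkcond [RHS](bigD1 ord0) //= inE mul1r.
  apply: eq_bigr => i i0; rewrite mS; last by rewrite lt0n.
  by case: (i \in S).
have rS U : U \subset V -> reduces (expA m) U = (S == U).
  move=> UV; rewrite -reduces_indic ?(subset_trans UV) //; apply: eq_reduces => j jle.
  by rewrite /expA /indic mS // inordK //; lia.
have [SV|nSV] := boolP (S \subset V).
  rewrite (bigD1 S) //= rS // eqxx scale1r XE big1 ?addr0 ?subrr; first exact: ideal0.
  by move=> U /andP[UV nU]; rewrite rS // eq_sym (negbTE nU) scale0r.
rewrite big1 ?subr0 => [|U UV]; last first.
  by rewrite rS //; case: eqP UV => [<-|_ _]; rewrite ?(negbTE nSV) ?scale0r.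
case/subsetPn: nSV => i iS iV; rewrite XE /eS (bigD1 i) //=.
apply: idealMl => //; apply: idealMr => //; apply: Gout => //.
by move/(subsetP Sp): iS; rewrite inE.
Qed.

(** The size of [p] bounds all exponents of [v], so any specialisation of [v] is a finite
    combination of the coefficients. *)
Lemma fA_coef phi U p K : (msize p <= K)%N ->
  fA phi U p = \sum_(k < K) coef k U p * phi k.
Proof.
move=> le; rewrite /coef /fA lextE.
under [RHS]eq_bigr => k _ do rewrite lextE mulr_suml.
rewrite exchange_big /=; apply: eq_big_seq => m mp.
have lt : (m ord0 < K)%N.
  apply: leq_trans le; apply: leq_ltn_trans (msize_mdeg_lt mp).
  by rewrite mdegE (bigD1 ord0) //= leq_addr.
rewrite (bigD1 (Ordinal lt)) //= eqxx mul1r big1 ?addr0 => [|k]; first by ring.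
rewrite -val_eqE /= eq_sym => /negbTE->; by rewrite mul0r mulr0 mul0r.
Qed.

Lemma normal_form (G : A s -> Prop) V : is_ideal G -> V \subset posi s ->
  (forall i, (0 < i <= s)%N -> G (eA s i ^+ 2 - eA s (2 * i))) ->
  (forall i : 'I_s.+1, (0 < i)%N -> i \notin V -> G 'X_i) ->
  forall p, G (p - \sum_(U : {set 'I_s.+1} | U \subset V)
     (\sum_(k < msize p) coef k U p *: vA s ^+ k) * eS U).
Proof.
move=> iG Vp Gsq Gout p.
have E U : \sum_(k < msize p) coef k U p *: vA s ^+ k =
    \sum_(m <- msupp p) p@_m *: ((reduces (expA m) U)%:R *: vA s ^+ m ord0).
  under eq_bigr => k _ do rewrite /coef /fA lextE scaler_suml.
  rewrite exchange_big /=; apply: eq_big_seq => m mp.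
  have lt : (m ord0 < msize p)%N.
    apply: leq_ltn_trans (msize_mdeg_lt mp).
    by rewrite mdegE (bigD1 ord0) //= leq_addr.
  rewrite (bigD1 (Ordinal lt)) //= eqxx mul1r scalerA big1 ?addr0 // => k.
  rewrite -val_eqE /= eq_sym => /negbTE->; by rewrite mul0r mulr0 scale0r.
under eq_bigr => U _ do rewrite E mulr_suml.
rewrite exchange_big /= {1}[p]mpolyE -sumrB; apply: ideal_sum => // m _.
under eq_bigr => U _ do rewrite -scalerAl -scalerAl.
rewrite -scaler_sumr -scalerBr -mul_mpolyC; apply: idealMl => //.
exact: normal_form_mon.
Qed.

Lemma fA_neq0 phi U p : fA phi U p != 0 ->
  exists m, [/\ m \in msupp p, reduces (expA m) U & phi (m ord0) != 0].
Proof.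
move=> nz; have [/hasP[m mp /andP[h1 h2]]|/hasPn h] :=
  boolP (has (fun m => reduces (expA m) U && (phi (m ord0) != 0)) (msupp p)).
  by exists m.
move: nz; rewrite [fA _ _ _]lext_eq0 ?eqxx // => m /h.
by case: (reduces _ _) => /=; rewrite ?mulr0 // negbK => /eqP->; rewrite mul0r.
Qed.

Lemma eS_mon S : S \subset posi s ->
  exists m, [/\ eS S = 'X_[m], m ord0 = 0%N & expA m =1 indic S].
Proof.
move=> Sp; rewrite /eS mprodXE.
set m := (\big[_/_]_(_ in _) _)%MM; exists m.
have mE j : m j = (j \in S).
  rewrite /m mnm_sumE big_mkcond (bigD1 j) //= mnm1E eqxx big1 ?addn0.
    by case: (_ \in _).
  by move=> i ij; case: ifP => //; rewrite mnm1E (negbTE ij).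
split=> // [|j]; last exact: mE.
by rewrite mE; apply/eqP; rewrite eqb0; apply/negP => /(subsetP Sp); rewrite inE.
Qed.

Lemma fA_eS phi U S : U \subset posi s -> S \subset posi s ->
  fA phi U (eS S) = phi 0%N * (S == U)%:R.
Proof.
move=> Up Sp; have [m [-> m0 mS]] := eS_mon Sp; rewrite [fA _ _ _]lextX m0.
by rewrite -(reduces_indic Sp Up) (@eq_reduces _ (expA m) (indic S)).
Qed.

Lemma eq_fA phi phi' U p : phi =1 phi' -> fA phi U p = fA phi' U p.
Proof. by move=> E; apply: eq_lext => m _; rewrite E. Qed.

End NormalForm.

Lemma F2_addxx N (b : {mpoly F2[N]}) : b + b = 0.
Proof.
rewrite -mulr2n -scaler_nat (_ : 2%:R = 0) ?scale0r //.
by apply/eqP.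
Qed.

Lemma F2_sqrD N (b c : {mpoly F2[N]}) : (b + c) ^+ 2 = b ^+ 2 + c ^+ 2.
Proof. by rewrite sqrrD mulr2n F2_addxx addr0. Qed.

(** * The coproduct and its leading terms *)

Section Coproduct.
Variables (n s : nat).
Hypothesis n_gt0 : (0 < n)%N.
Implicit Types (U V W S Z : {set 'I_s.+1}) (p q : A s) (eps : F2).

Definition delta_red (o : nat) : B s :=
  if (o < 2 ^ n - 1)%N then
     let k := ((2 ^ n - 1 - o) %/ 2)%N in
     let E i := angle n (k %/ 2 ^ i) in
     \sum_(i < (logn 2 k).+1)
        vB s ^+ i.+1 * ex s (E i) * ey s (E i) *
        \prod_(j < i) (ex s (E j) + ey s (E j))
   else if o == (2 ^ n - 1)%N then vB s * ex s o * ey s o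
   else 0.

(* The paper's <k> for o = <2k>. *)
Definition dmid (o : nat) : nat := (2 ^ n - 1 - (2 ^ n - 1 - o) %/ 2)%N.

Lemma delta_oddE o : delta_odd n s o = ex s o + ey s o + delta_red o.
Proof. by []. Qed.

Lemma odd_2n1 : odd (2 ^ n - 1).
Proof. by rewrite oddB ?expn_gt0 // oddX eqn0Ngt n_gt0. Qed.

Lemma dmidE o : odd o -> (o < 2 ^ n)%N -> ((dmid o).*2 = o + (2 ^ n - 1))%N.
Proof.
move=> oo lt; have oN := odd_2n1; rewrite /dmid; move: (2 ^ n)%N lt oN => N lt oN.
have := odd_double_half (N - 1 - o); rewrite divn2 (_ : odd _ = false); first lia.
by rewrite oddB ?oN ?oo //; lia.
Qed.

(** Each term is a multiple of some [v e_E (x) e_E] with [E = <k/2^i>], and [<k> <= E < 2^n]. The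
    bound on [E.*2.+1] is [E >= <k>] rewritten through [2<k> = o + 2^n - 1]. *)
Lemma delta_red_ideal (G : B s -> Prop) o : is_ideal G -> odd o ->
  (forall E, (o + 2 ^ n <= E.*2.+1)%N -> (E < 2 ^ n)%N -> G (vB s * ex s E * ey s E)) ->
  G (delta_red o).
Proof.
move=> iG oo GE; rewrite /delta_red; have N0 : (0 < 2 ^ n)%N by rewrite expn_gt0.
case: ifP => lt; last first.
  by case: eqP => [E|_]; [apply: GE; lia|apply: ideal0].
apply: ideal_sum => // i _; apply: idealMr => //.
rewrite exprS -!mulrA mulrCA; apply: idealMl => //; rewrite mulrA; apply: GE.
  have := dmidE oo (ltac:(lia) : (o < 2 ^ n)%N); rewrite /angle.
  have : (dmid o <= 2 ^ n - 1 - (2 ^ n - 1 - o) %/ 2 %/ 2 ^ i)%N.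
    by rewrite /dmid leq_sub2l // leq_div.
  lia.
by rewrite /angle (leq_ltn_trans (leq_subr _ _)) // ltn_subrL.
Qed.

(** Each term has a factor coming from [e_<k>]: the term [i = 0] contains [e_<k> (x) e_<k>], and the
    later ones contain the factor [j = 0] of the product. *)
Lemma delta_red_mid (G : B s -> Prop) o : is_ideal G -> odd o ->
  ((o < 2 ^ n)%N -> G (ex s (dmid o)) /\ G (ey s (dmid o))) -> G (delta_red o).
Proof.
move=> iG oo GE; rewrite /delta_red; have N0 : (0 < 2 ^ n)%N by rewrite expn_gt0.
case: ifP => lt; last first.
  case: eqP => [E|_]; last exact: ideal0.
  have E' : dmid o = o by have := dmidE oo (ltac:(lia) : (o < 2 ^ n)%N); lia.
  by have [|+ _] := GE; first lia; rewrite E' E => Gx; apply: idealMr => //; apply: idealMl.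
have [|Gx Gy] := GE; first lia.
apply: ideal_sum => // -[[|i] lti] _ /=.
  rewrite expn0 divn1 -/(dmid o); do 2!apply: idealMr => //; exact: idealMl.
rewrite big_ord_recl /= expn0 divn1 -/(dmid o); apply: idealMl => //.
by apply: idealMr => //; apply: idealD.
Qed.

Lemma delta_varE o c : odd o -> delta_var n s (o * 2 ^ c) = delta_odd n s o ^+ (2 ^ c).
Proof.
move=> oo; have lE : logn 2 (o * 2 ^ c) = c.
  rewrite (lognM _ (odd_gt0 oo)) ?expn_gt0 // pfactorK //.
  suff -> : logn 2 o = 0%N by [].
  by apply/eqP; rewrite -leqn0 leqNgt logn_gt0 mem_primes /= odd_gt0 //= dvdn2 oo.
by rewrite /delta_var lE mulnK // expn_gt0.
Qed.

Lemma delta_var_odd o : odd o -> delta_var n s o = delta_odd n s o.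
Proof. by move=> oo; have := delta_varE 0 oo; rewrite muln1 expr1. Qed.

Lemma delta_var_double i : (0 < i)%N -> delta_var n s i.*2 = delta_var n s i ^+ 2.
Proof.
move=> /odd_pow2P[o [c [oo ->]]].
by rewrite -mul2n mulnCA -expnS !delta_varE // -exprM -expnSr.
Qed.

Lemma filt_ideal d : is_ideal (@filt s d).
Proof.
split; [exact: filt0|by move=> p q; apply: filtD|move=> a p fp].
by rewrite -[d]add0n; apply: filtM.
Qed.

(** Each term has weight at least [2E >= o + 2^n - 1], which exceeds [o] because [2^n >= 2]. *)
Lemma filt_delta_red o : odd o -> filt o.+1 (delta_red o).
Proof.
move=> oo; apply: delta_red_ideal => //; first exact: filt_ideal.
move=> E h _; rewrite -mulrA; apply: (idealMl _ (filt_ideal _)).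
apply: (@filtW _ (E + E)); last by apply: filtM; [apply: filt_x|apply: filt_y].
have : (2 ^ 1 <= 2 ^ n)%N by rewrite leq_exp2l.
by lia.
Qed.

Lemma Delta_v : Delta n s (vA s) = vB s.
Proof. by rewrite /Delta vAE comp_mpolyXU -tnth_nth tnth_mktuple. Qed.

Lemma Delta_X (i : 'I_s.+1) : (0 < i)%N -> Delta n s 'X_i = delta_var n s i.
Proof.
by move=> i0; rewrite /Delta comp_mpolyXU -tnth_nth tnth_mktuple eqn0Ngt i0.
Qed.

Lemma Delta_eA i : (0 < i <= s)%N -> Delta n s (eA s i) = delta_var n s i.
Proof.
by move=> ile; rewrite eAEn // Delta_X inordK //; lia.
Qed.

Lemma Delta_eS S : S \subset posi s -> Delta n s (eS S) = \prod_(i in S) delta_var n s i.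
Proof.
move=> Sp; rewrite /Delta /eS rmorph_prod /=; apply: eq_bigr => i /(subsetP Sp).
by rewrite inE => i0; rewrite -/(Delta n s _) Delta_X.
Qed.

(** * The coproduct with [v] specialised to [eps] and [e_i] set to 0 outside [V] *)

Section Kernel.
Variables (eps : F2) (V : {set 'I_s.+1}).
Hypothesis V_pos : V \subset posi s.
Hypothesis V_down : downclosed V.
Hypothesis V_eps : eps = 0 \/ (forall i, i \in V -> (i < 2 ^ n)%N).

Let K := kerB eps V.
Let iK : is_ideal K := kerB_ideal eps V.

Lemma kerB_eq U W b c : U \subset V -> W \subset V -> K (b - c) ->
  fB eps U W b = fB eps U W c.
Proof.
move=> UV WV /(_ U W UV WV 1); rewrite mul1r raddfB /= => /eqP.
by rewrite subr_eq0 => /eqP.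
Qed.

Lemma kerB_vB : eps = 0 -> K (vB s).
Proof.
move=> e0; have -> : vB s = vB s - eps%:MP by rewrite e0 mpolyC0 subr0.
exact: kerB_v.
Qed.

Lemma kerB_delta_red0 o : odd o -> eps = 0 -> K (delta_red o).
Proof.
move=> oo e0; apply: (delta_red_ideal iK oo) => E _ _; rewrite -mulrA.
by apply: (idealMr _ iK); apply: kerB_vB.
Qed.

Lemma kerB_sq_ideal : is_ideal (fun b => K (b ^+ 2)).
Proof.
split=> [|p q Kp Kq|a p Kp]; first by rewrite expr0n; apply: (ideal0 iK).
  by rewrite F2_sqrD; apply: (idealD iK).
by rewrite exprMn; apply: (idealMl _ iK).
Qed.

(** For [eps = 0] the factor [v] vanishes. Otherwise the square of a term contains [e_E^2 = e_(2E)]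
    with [2E >= 2^n], and such indices lie outside [V]. Consequently the generators of even index
    are primitive modulo the kernel. *)
Lemma kerB_delta_red_sq o : odd o -> K (delta_red o ^+ 2).
Proof.
move=> oo; case: V_eps => [e0|Vn].
  by rewrite expr2; apply: (idealMl _ iK); apply: kerB_delta_red0.
apply: (delta_red_ideal kerB_sq_ideal oo) => E h _.
rewrite mulrAC; apply: (idealMl _ kerB_sq_ideal).
have E0 : (0 < E)%N.
  have N0 : (0 < 2 ^ n)%N by rewrite expn_gt0.
  by move: (odd_gt0 oo); lia.
rewrite -[_ ^+ 2](subrK (ex s E.*2)); apply: (idealD iK); first exact: kerB_sqx.
apply: kerB_outx => // [|le]; first by rewrite double_gt0.
by apply/negP => /Vn; rewrite inordK // ltnNge; move: (odd_gt0 oo); lia.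
Qed.

Lemma kerB_square b i : (0 < i)%N -> K ((b - (ex s i + ey s i)) ^+ 2) ->
  K (b ^+ 2 - (ex s i.*2 + ey s i.*2)).
Proof.
move=> i0 Kb; rewrite -{1}[b](subrK (ex s i + ey s i)) F2_sqrD F2_sqrD.
rewrite -addrA (_ : ex s i ^+ 2 + _ - _ =
  (ex s i ^+ 2 - ex s i.*2) + (ey s i ^+ 2 - ey s i.*2)); last by ring.
apply: (idealD iK) => //; apply: (idealD iK); [exact: kerB_sqx|exact: kerB_sqy].
Qed.

Lemma delta_even i : (0 < i)%N ->
  K (delta_var n s i.*2 - (ex s i.*2 + ey s i.*2)).
Proof.
move=> i0; have [o [c [oo ->]]] := odd_pow2P i0; elim: c => [|c IH].
  rewrite muln1 delta_var_double ?odd_gt0 // delta_var_odd // delta_oddE.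
  apply: kerB_square; rewrite ?odd_gt0 // addrC addrA addNr add0r.
  exact: kerB_delta_red_sq.
have pc : (0 < o * 2 ^ c)%N by rewrite muln_gt0 odd_gt0 // expn_gt0.
have -> : (o * 2 ^ c.+1 = (o * 2 ^ c).*2)%N by rewrite expnS mulnCA mul2n.
rewrite delta_var_double ?double_gt0 //.
apply: kerB_square; rewrite ?double_gt0 // expr2; exact: (idealMl _ iK).
Qed.

Lemma delta_var_congr i : (0 < i)%N ->
  K (delta_var n s i - (ex s i + ey s i + (if odd i then delta_red i else 0))).
Proof.
move=> i0; case: ifP => oi.
  by rewrite delta_var_odd // delta_oddE subrr; apply: (ideal0 iK).
rewrite addr0 -(odd_double_half i) oi add0n; apply: delta_even.
by move: i0; rewrite -{1}(odd_double_half i) oi add0n double_gt0.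
Qed.

(** The primitive part vanishes since [i] is outside [V]. The reduced part vanishes either with [v]
    or, by [delta_red_mid], with [e_<k>]; this is why the indices outside [V] must be stable under
    [<2k> |-> <k>] when [eps] is nonzero. *)
Lemma delta_out (i : 'I_s.+1) : (0 < i)%N -> i \notin V ->
  (odd i -> (i < 2 ^ n)%N -> (dmid i <= s)%N ->
     eps = 0 \/ (inord (dmid i) : 'I_s.+1) \notin V) ->
  K (delta_var n s i).
Proof.
move=> i0 iV hmid; set d := ex s i + ey s i + (if odd i then delta_red i else 0).
rewrite -[delta_var n s i](subrK d); apply: (idealD iK); first exact: delta_var_congr.
apply: (idealD iK).
  by apply: (idealD iK); [apply: kerB_outx|apply: kerB_outy]; rewrite // inord_val.
case: ifP => oi; last exact: (ideal0 iK).
case: (V_eps) => [e0|_]; first exact: kerB_delta_red0.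
have [e0|/eqP e0] := eqVneq eps 0; first exact: kerB_delta_red0.
apply: (delta_red_mid iK oi) => lt; have := dmidE oi lt => E.
have m0 : (0 < dmid i)%N by lia.
by split; [apply: kerB_outx|apply: kerB_outy] => // le; case: (hmid oi lt le).
Qed.

Hypothesis V_out : forall i : 'I_s.+1, (0 < i)%N -> i \notin V -> K (delta_var n s i).

(** By [V_out] the coproduct descends to the quotient, so [p] may be replaced by its normal form. *)
Lemma kerB_Delta p :
  K (Delta n s p - \sum_(S : {set 'I_s.+1} | S \subset V)
       (\sum_(k < msize p) coef k S p *: vB s ^+ k) * Delta n s (eS S)).
Proof.
have iG : is_ideal (fun p => K (Delta n s p)).
  rewrite /Delta; split=> [|p1 p2 K1 K2|a p1 K1]; first by rewrite raddf0; apply: (ideal0 iK).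
    by rewrite raddfD /=; apply: (idealD iK).
  by rewrite rmorphM /=; apply: (idealMl _ iK).
have : K (Delta n s (p - \sum_(U : {set 'I_s.+1} | U \subset V)
     (\sum_(k < msize p) coef k U p *: vA s ^+ k) * eS U)).
  apply: (normal_form iG V_pos) => [i ile|i i0 iV]; last by rewrite Delta_X //; apply: V_out.
  rewrite /Delta raddfB /= rmorphXn /= -!/(Delta n s _) Delta_eA //.
  rewrite -delta_var_double; last by lia.
  have i0 : (0 < i)%N by lia.
  have -> : (2 * i = i.*2)%N by rewrite mul2n.
  (* For [2i > s] the generator [e_(2i)] is zero, and [delta_even] shows that the square of the
     coproduct of [e_i] vanishes as well. *)
  have [le|lt] := leqP i.*2 s.
    by rewrite Delta_eA ?subrr; [apply: (ideal0 iK)|lia].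
  rewrite eA0 // /Delta raddf0; have := delta_even i0.
  by rewrite ex0 // ey0 // addr0.
congr K; rewrite /Delta rmorphB /=; congr (_ - _).
rewrite [LHS](rmorph_sum (comp_mpoly _)) /=; apply: eq_bigr => S _.
rewrite rmorphM /=; congr (_ * _); rewrite [LHS](rmorph_sum (comp_mpoly _)) /=.
apply: eq_bigr => k _; rewrite comp_mpolyZ rmorphXn /=.
by rewrite -/(Delta n s _) Delta_v.
Qed.

Lemma fB_vexp U W k b : U \subset V -> W \subset V ->
  fB eps U W (vB s ^+ k * b) = eps ^+ k * fB eps U W b.
Proof.
move=> UV WV; elim: k => [|k IH]; first by rewrite !expr0 !mul1r.
have /(_ U W UV WV (vB s ^+ k * b)) := @kerB_v s eps V.
rewrite mulrBr raddfB /= => /eqP; rewrite subr_eq0 => /eqP.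
rewrite exprS -mulrA mulrC => ->; rewrite mulrC mul_mpolyC [fB _ _ _ _]lextZ.
by rewrite -/(fB eps U W _) IH exprS mulrA.
Qed.

Lemma fB_Delta U W p : U \subset V -> W \subset V ->
  fB eps U W (Delta n s p) = \sum_(S : {set 'I_s.+1} | S \subset V)
    fA (fun k => eps ^+ k) S p * fB eps U W (Delta n s (eS S)).
Proof.
move=> UV WV; apply: etrans (kerB_eq UV WV (kerB_Delta p)) _.
rewrite [LHS](raddf_sum (fB eps U W)); apply: eq_bigr => S _.
rewrite (@fA_coef _ _ _ _ (msize p)) // !mulr_suml.
rewrite [LHS](raddf_sum (fB eps U W)); apply: eq_bigr => k _.
by rewrite -scalerAl [LHS]lextZ -/(fB eps U W _) fB_vexp // mulrA.
Qed.

Let dlead (i : 'I_s.+1) : B s := ex s i + ey s i.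
Let dapx (i : 'I_s.+1) : B s := dlead i + (if odd i then delta_red i else 0).

(** The reduced coproducts strictly raise the weight, so replacing each factor by its primitive part
    changes the product only in higher weight. *)
Lemma filt_prod (r : seq 'I_s.+1) :
  filt (\sum_(i <- r) i) (\prod_(i <- r) dlead i) /\
  filt (\sum_(i <- r) i).+1 (\prod_(i <- r) dapx i - \prod_(i <- r) dlead i).
Proof.
elim: r => [|i r [IH1 IH2]]; first by rewrite !big_nil subrr; split=> //; apply: filt0.
have fl : filt i (dlead i) by apply: filtD; [apply: filt_x|apply: filt_y].
rewrite !big_cons; split; first exact: filtM.
have -> : dapx i * \prod_(j <- r) dapx j - dlead i * \prod_(j <- r) dlead j =
  dlead i * (\prod_(j <- r) dapx j - \prod_(j <- r) dlead j) +
  (if odd i then delta_red i else 0) *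
    (\prod_(j <- r) dlead j + (\prod_(j <- r) dapx j - \prod_(j <- r) dlead j)).
  by rewrite /dapx; ring.
apply: filtD; first by rewrite -addnS; apply: filtM.
rewrite -addSn; apply: filtM; last by apply: filtD => //; apply: filtW IH2.
by case: ifP => oi; [apply: filt_delta_red|apply: filt0].
Qed.

Lemma fB_DeltaS U W S : U \subset V -> W \subset V -> S \subset V ->
  (swt U + swt W <= swt S)%N ->
  fB eps U W (Delta n s (eS S)) = fB eps U W (\prod_(i in S) (ex s i + ey s i)).
Proof.
move=> UV WV SV le; rewrite Delta_eS ?(subset_trans SV) // -!big_enum /=.
set r := enum S.
have rE : (\sum_(i <- r) i = swt S)%N by rewrite /r big_enum.
have KS : K (\prod_(i <- r) delta_var n s i - \prod_(i <- r) dapx i).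
  apply: (ideal_prod_congr iK) => i; rewrite mem_enum => /(subsetP SV)/(subsetP V_pos).
  by rewrite inE; apply: delta_var_congr.
rewrite (kerB_eq UV WV KS).
have [_ h] := filt_prod r; apply/eqP; rewrite -subr_eq0 -raddfB /=; apply/eqP.
by apply: (fB_filt _ h); rewrite rE ltnS.
Qed.

Lemma prod_xy S : \prod_(i in S) (ex s i + ey s i) =
  \sum_(Z : {set 'I_s.+1} | Z \subset S) monX Z * monY (S :\: Z).
Proof.
rewrite big_mkcond /= (eq_bigr (fun i => (if i \in S then ex s i else 0) +
  (if i \in S then ey s i else 1))); last first.
  by move=> i _; case: ifP; rewrite ?add0r.
rewrite bigA_distr [RHS]big_mkcond /=; apply: eq_bigr => Z _; case: ifP => [ZS|/negbT].
  rewrite /monX /monY (bigID (mem Z)) /=; congr (_ * _).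
    by apply: eq_bigr => i iZ; rewrite iZ (subsetP ZS).
  rewrite [RHS]big_mkcond [LHS]big_mkcond; apply: eq_bigr => i _; rewrite inE.
  by case: (i \in Z); case: (i \in S).
by case/subsetPn => i iZ iS; rewrite (bigD1 i) //= iZ (negbTE iS) mul0r.
Qed.

(** Under the weight bound only the leading part [prod (e_i (x) 1 + 1 (x) e_i)] counts. It expands
    into the [e_Z (x) e_(S - Z)], among which the functional picks [Z = U]. *)
Lemma fB_Delta_eq U W S : U \subset V -> W \subset V -> S \subset V ->
  (swt U + swt W <= swt S)%N ->
  fB eps U W (Delta n s (eS S)) = ((U \subset S) && (S :\: U == W))%:R.
Proof.
move=> UV WV SV le; rewrite fB_DeltaS // prod_xy [LHS](raddf_sum (fB eps U W)).
have p1 := subset_trans UV V_pos; have p2 := subset_trans WV V_pos.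
have p3 := subset_trans SV V_pos.
have E Z : Z \subset S -> fB eps U W (monX Z * monY (S :\: Z)) =
    ((Z == U) && (S :\: Z == W))%:R.
  by move=> ZS; rewrite fB_mon // ?(subset_trans ZS) // ?(subset_trans (subsetDl _ _)).
rewrite (eq_bigr _ E); have [US|nUS] := boolP (U \subset S).
  rewrite (bigD1 U) //= eqxx big1 ?addr0 // => Z /andP[_ /negbTE->] //.
by rewrite big1 // => Z ZS; case: eqP => [ZU|//]; rewrite -ZU ZS in nUS.
Qed.

End Kernel.

(** * Functionals vanishing on a bi-ideal *)

Section BiIdeal.
Variable I : A s -> Prop.
Hypotheses (iI : is_ideal I) (bI : bi_ideal n s I).

(** In [I (x) H + H (x) I] each summand is killed by one of the two tensor factors of the
    functional. *)
Lemma fB_biideal eps U W :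
  (forall p, I p -> fA (fun k => eps ^+ k) U p = 0) ->
  (forall p, I p -> fA (fun k => eps ^+ k) W p = 0) ->
  forall p, I p -> fB eps U W (Delta n s p) = 0.
Proof.
move=> KU KW p /bI[_ [cs [Hc ->]]]; rewrite [LHS](raddf_sum (fB eps U W)) big1_seq //= => c /Hc.
case=> r [Ir [->|->]]; [apply: fB_incl_x|apply: fB_incl_y] => a;
  [apply: KU|apply: KW]; exact: idealMl.
Qed.

(** The functional of [{i}] and [U - {i}] is evaluated on the coproduct of [p]. It vanishes, as both
    sets have smaller weight than [U]; in its expansion the sets [S] lighter than [U] contribute 0
    by induction, and among the others only [S = U] contributes. *)
Lemma fA_step eps V U (i : 'I_s.+1) : V \subset posi s -> downclosed V ->
  (eps = 0 \/ (forall i, i \in V -> (i < 2 ^ n)%N)) ->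
  (forall i : 'I_s.+1, (0 < i)%N -> i \notin V -> kerB eps V (delta_var n s i)) ->
  U \subset V -> i \in U -> U != [set i] ->
  (forall S, S \subset V -> (swt S < swt U)%N ->
     forall p, I p -> fA (fun k => eps ^+ k) S p = 0) ->
  forall p, I p -> fA (fun k => eps ^+ k) U p = 0.
Proof.
move=> Vp Vd Ve Vo UV iU nU IH p Ip.
have swtD : swt U = (i + swt (U :\ i))%N by rewrite /swt (big_setD1 i).
have swt1 : swt [set i] = i :> nat by rewrite /swt big_set1.
have i0 : (0 < i)%N by move/(subsetP UV)/(subsetP Vp): iU; rewrite inE.
have Ui0 : (0 < swt (U :\ i))%N.
  have /set0Pn[j jU] : U :\ i != set0.
    by apply: contra nU; rewrite setD_eq0 subset1 => /orP[//|/eqP U0]; rewrite U0 inE in iU.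
  rewrite /swt (big_setD1 j) //= (leq_trans _ (leq_addr _ _)) //.
  by move: jU; rewrite inE => /andP[_ /(subsetP UV)/(subsetP Vp)]; rewrite inE.
have iV : [set i] \subset V by rewrite sub1set (subsetP UV).
have UiV : U :\ i \subset V by rewrite (subset_trans _ UV) // subsetDl.
have : fB eps [set i] (U :\ i) (Delta n s p) = 0.
  apply: fB_biideal => //; apply: IH => //; lia.
have kap S : S \subset V -> (swt U <= swt S)%N ->
    fB eps [set i] (U :\ i) (Delta n s (eS S)) = (S == U)%:R.
  move=> SV le; rewrite (fB_Delta_eq Vp Vd Ve iV UiV SV); last by lia.
  congr (nat_of_bool _)%:R; apply/andP/eqP => [[iS /eqP E]|->].
    by rewrite -(setD1K iU) -E setD1K // -sub1set.
  by rewrite sub1set iU.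
rewrite (fB_Delta Vp Vd Ve Vo p iV UiV); move: (Delta n s) kap => D kap.
rewrite (bigD1 U UV) (kap U UV (leqnn _)) eqxx mulr1 big1 => [|S /andP[SV nS]].
  by rewrite /= addr0.
have [lt|ge] := ltnP (swt S) (swt U); first by rewrite (IH _ SV lt) // mul0r.
by rewrite kap // (negbTE nS) mulr0.
Qed.

End BiIdeal.

End Coproduct.

(** * Homogeneous components *)

Section Homogeneous.
Variables (n s : nat).
Implicit Types (U S : {set 'I_s.+1}) (p q : A s) (d : int).

Lemma wdegE (m : 'X_{1..s.+1}) :
  wdeg n s m = (fwt s (expA m))%:Z - (m ord0)%:Z * ((2 ^ n)%:Z - 1).
Proof.
have -> : (fwt s (expA m))%:Z = \sum_(i < s.+1) (i * m i)%:Z.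
  rewrite /fwt (big_morph Posz PoszD (erefl _)); apply: eq_bigr => i _.
  by rewrite /expA inord_val.
rewrite /wdeg (bigD1 ord0) //= [X in _ = X - _](bigD1 ord0) //=.
rewrite mul0n add0r addrC; congr (_ + _).
  apply: eq_bigr => i /negbTE->; by rewrite mulnC PoszM.
by rewrite -mulrN opprB.
Qed.

Lemma hcompE d p : hcomp n s d p =
  \sum_(m <- msupp p) (if wdeg n s m == d then p@_m else 0) *: 'X_[m].
Proof.
rewrite /hcomp big_mkcond; apply: eq_bigr => m _.
by case: ifP; rewrite ?scale0r.
Qed.

Lemma mcoeff_hcomp d p m : (hcomp n s d p)@_m = if wdeg n s m == d then p@_m else 0.
Proof.
rewrite hcompE raddf_sum /=.
under eq_bigr => k _ do rewrite mcoeffZ mcoeffX.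
have [mp|mp] := boolP (m \in msupp p).
  rewrite (bigD1_seq m) ?msupp_uniq //= eqxx mulr1 big1 ?addr0 // => k /negbTE->.
  by rewrite mulr0.
rewrite (memN_msupp_eq0 mp) if_same big1_seq // => k /andP[_ kp].
case: (k =P m) => [E|_]; last by rewrite mulr0.
by rewrite -E kp in mp.
Qed.

Lemma hcomp_is_additive d : zmod_morphism (hcomp n s d).
Proof.
move=> p q; apply/mpolyP => m; rewrite mcoeffB !mcoeff_hcomp mcoeffB.
by case: ifP; rewrite ?subr0.
Qed.

HB.instance Definition _ d :=
  GRing.isZmodMorphism.Build (A s) (A s) (hcomp n s d) (hcomp_is_additive d).

Lemma hcompX d m : hcomp n s d 'X_[m] = if wdeg n s m == d then 'X_[m] else 0.
Proof.
rewrite hcompE msuppX big_seq1 mcoeffX eqxx.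
by case: ifP; rewrite ?scale1r ?scale0r.
Qed.

Lemma hcompZ d c p : hcomp n s d (c *: p) = c *: hcomp n s d p.
Proof.
by apply/mpolyP => m; rewrite mcoeffZ !mcoeff_hcomp mcoeffZ; case: ifP; rewrite ?mulr0.
Qed.

Lemma lext_hcomp (chi : 'X_{1..s.+1} -> F2) d p : lext chi (hcomp n s d p) =
  \sum_(m <- msupp p) (if wdeg n s m == d then p@_m * chi m else 0).
Proof.
rewrite hcompE [LHS](raddf_sum (lext chi)); apply: eq_bigr => m _ /=.
by rewrite lextZ lextX; case: ifP; rewrite ?mul0r.
Qed.

(** All monomials reducing to [v^k e_U] have the degree [swt U - k (2^n - 1)]. *)
Lemma coef_hcomp k U p :
  coef k U (hcomp n s ((swt U)%:Z - k%:Z * ((2 ^ n)%:Z - 1)) p) = coef k U p.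
Proof.
rewrite /coef /fA lext_hcomp lextE; apply: eq_bigr => m _.
have [r|_] := boolP (reduces (expA m) U); last by rewrite !mulr0 if_same.
have [E|_] := eqVneq (m ord0) k; last by rewrite mul0r mulr0 if_same.
by rewrite wdegE (reduces_wt r) E eqxx.
Qed.

Lemma msupp_hcomp d p m : m \in msupp (hcomp n s d p) -> wdeg n s m = d.
Proof.
by rewrite mcoeff_msupp mcoeff_hcomp; case: (wdeg n s m =P d) => // _; rewrite eqxx.
Qed.

Lemma coef_hcomp_deg k U d p : coef k U (hcomp n s d p) != 0 ->
  d = (swt U)%:Z - k%:Z * ((2 ^ n)%:Z - 1).
Proof.
case/fA_neq0 => m [/msupp_hcomp <- r]; rewrite wdegE (reduces_wt r).
by have [->|_] := eqVneq (m ord0) k; rewrite ?eqxx.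
Qed.

Lemma hcomp_vA d q : hcomp n s d (vA s * q) = vA s * hcomp n s (d + ((2 ^ n)%:Z - 1)) q.
Proof.
rewrite {1}[q]mpolyE mulr_sumr [LHS](raddf_sum (hcomp n s d)) hcompE mulr_sumr.
apply: eq_bigr => m _ /=; rewrite -scalerAr hcompZ vAE -mpolyXD hcompX.
have -> : wdeg n s (U_(ord0) + m)%MM = wdeg n s m - ((2 ^ n)%:Z - 1).
  rewrite !wdegE mnmDE mnm1E eqxx (@eq_fwt _ (expA (_ + _)) (expA m)).
    by rewrite PoszD mulrDl mul1r opprD addrCA addrC.
  by move=> j jle; rewrite expAD {1}/expA mnm1E eq_sym inord_eq0 //; lia.
rewrite subr_eq; case: ifP => _; last by rewrite scaler0 scale0r mulr0.
by rewrite -scalerAr -mpolyXD.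
Qed.

Lemma hcomp_eS S : S \subset posi s -> hcomp n s (swt S) (eS S) = eS S.
Proof.
move=> Sp; have [m [-> m0 mS]] := eS_mon Sp; rewrite hcompX wdegE m0 mul0r subr0.
rewrite (@reduces_wt _ _ S) ?eqxx // (@eq_reduces _ (expA m) (indic S)) //.
by rewrite reduces_indic.
Qed.

End Homogeneous.

(** * Lifting saturation from [H_0] to [H] *)

Section Saturation.
Variables (n s s0 : nat).
Hypothesis s0E : s0 = minn s (2 ^ n - 1).

Lemma restrX s1 s2 (i : 'I_s1.+1) : restr s1 s2 'X_i =
  if i == 0%N :> nat then vA s2 else eA s2 i.
Proof. by rewrite /restr comp_mpolyXU -tnth_nth tnth_mktuple. Qed.

Lemma restrC s1 s2 c : restr s1 s2 c%:MP = c%:MP. Proof. exact: comp_mpolyC. Qed.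
Lemma restr0 s1 s2 : restr s1 s2 0 = 0. Proof. exact: raddf0. Qed.
Lemma restrD s1 s2 p q : restr s1 s2 (p + q) = restr s1 s2 p + restr s1 s2 q.
Proof. exact: raddfD. Qed.
Lemma restrB s1 s2 p q : restr s1 s2 (p - q) = restr s1 s2 p - restr s1 s2 q.
Proof. exact: raddfB. Qed.
Lemma restrM s1 s2 p q : restr s1 s2 (p * q) = restr s1 s2 p * restr s1 s2 q.
Proof. exact: rmorphM. Qed.

Lemma restr_vA s1 s2 : restr s1 s2 (vA s1) = vA s2.
Proof. by rewrite vAE restrX. Qed.

Lemma restr_eA s1 s2 i : (0 < i <= s1)%N -> restr s1 s2 (eA s1 i) = eA s2 i.
Proof. by move=> ile; rewrite eAEn // restrX inordK ?ifF //; lia. Qed.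

Lemma Rel_v_eA i : (2 ^ n <= i)%N -> Rel n s (vA s * eA s i).
Proof.
have [le|lt] := leqP i s; last by rewrite eA0 // mulr0 => _; apply: ideal0 (gen_ideal_ideal _).
by move=> ge; apply: gen_ideal_mem; right; exists i; rewrite ge le.
Qed.

Lemma Rel_sq i : (0 < i <= s)%N -> Rel n s (eA s i ^+ 2 - eA s (2 * i)).
Proof. by move=> ile; apply: gen_ideal_mem; left; exists i. Qed.

Lemma ideal_var_congr N (R : comNzRingType) (J : {mpoly R[N]} -> Prop) v
    (f : {mpoly R[N]} -> {mpoly R[N]}) : is_ideal J ->
  (forall c, f c%:MP = c%:MP) -> {morph f : p q / p + q} -> {morph f : p q / p * q} ->
  (forall i, J (v * ('X_i - f 'X_i))) -> forall x, J (v * (x - f x)).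
Proof.
move=> iJ fC fD fM fX; elim/mpoly_ind_ring => [c|//|p q Jp Jq|p q Jp Jq].
- by rewrite fC subrr mulr0; apply: (ideal0 iJ).
- by rewrite fD opprD addrACA mulrDr; apply: (idealD iJ).
- rewrite fM (_ : _ * _ = p * (v * (q - f q)) + f q * (v * (p - f p))); last by ring.
  by apply: (idealD iJ); apply: (idealMl _ iJ).
Qed.

(** The restriction forgets only the [e_i] with [i >= 2^n], which are killed by [v]; so [v x]
    depends only on the restriction of [x]. *)
Lemma Rel_v_section x : Rel n s (vA s * (x - restr s0 s (restr s s0 x))).
Proof.
have iR : is_ideal (Rel n s) := gen_ideal_ideal _.
apply: (@ideal_var_congr _ _ _ _ (fun x => restr s0 s (restr s s0 x)) iR).
- by move=> c; rewrite !restrC.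
- by move=> p q; rewrite !restrD.
- by move=> p q; rewrite !restrM.
move=> i; rewrite restrX; case: eqP => [E|/eqP i0].
  rewrite restr_vA vAE (_ : i = ord0) ?subrr ?mulr0; first exact: (ideal0 iR).
  exact: val_inj.
have [le|lt] := leqP i s0.
  rewrite restr_eA ?lt0n ?i0 // eAE ?lt0n // subrr mulr0; exact: (ideal0 iR).
rewrite eA0 // restr0 subr0 -eAE ?lt0n //; apply: Rel_v_eA.
by move: (ltn_ord i); lia.
Qed.

(** The section [e_i |-> e_i] does not respect [e_i^2 = 0] when [s0 < 2i <= s], but then
    [v e_(2i) = 0] in [H], so the relation holds after multiplication by [v]. *)
Lemma Rel_v_restr y : Rel n s0 y -> Rel n s (vA s * restr s0 s y).
Proof.
have iR : is_ideal (Rel n s) := gen_ideal_ideal _.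
apply: (gen_ideal_min (I := fun y => Rel n s (vA s * restr s0 s y))).
  split=> [|p q Rp Rq|a p Rp].
  - by rewrite restr0 mulr0; apply: (ideal0 iR).
  - by rewrite restrD mulrDr; apply: (idealD iR).
  - by rewrite restrM mulrCA; apply: (idealMl _ iR).
move=> g [[i [ile ->]]|[i [ile ->]]]; last by move: ile; lia.
rewrite restrB expr2 restrM -expr2 restr_eA //.
have ile' : (0 < i <= s)%N by lia.
have [le|lt] := leqP (2 * i) s0.
  by rewrite restr_eA; [apply: (idealMl _ iR); apply: Rel_sq|lia].
rewrite (eA0 lt) restr0 subr0 -[_ ^+ 2](subrK (eA s (2 * i))) mulrDr.
apply: (idealD iR) => //; first by apply: (idealMl _ iR); apply: Rel_sq.
have [le|lt'] := leqP (2 * i) s; first by apply: Rel_v_eA; lia.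
by rewrite (eA0 lt') mulr0; apply: (ideal0 iR).
Qed.

(** Saturation of the image provides [q] in [I] with the same restriction as [p], and then [v] kills
    [p - q]. *)
Lemma saturated_lift (I : A s -> Prop) : saturated s0 (image_ideal n s s0 I) ->
  forall p, I (vA s * p) -> exists q, I q /\ Rel n s (vA s * (p - q)).
Proof.
move=> sat p Ivp; have iR : is_ideal (Rel n s) := gen_ideal_ideal _.
have /sat[q [Iq Rq]] : image_ideal n s s0 I (vA s0 * restr s s0 p).
  exists (vA s * p); split=> //; rewrite restrM.
  by rewrite restr_vA subrr; apply: ideal0 (gen_ideal_ideal _).
exists q; split=> //.
have := Rel_v_section (p - q); have := Rel_v_restr Rq.
rewrite -restrB => R1 R2.
have := idealD iR R2 R1.
by rewrite -mulrDr subrK.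
Qed.

End Saturation.

(** * Determination of the bi-ideal by the set [T] *)

Section BiIdealStructure.
Variables (n s : nat) (I : A s -> Prop).
Hypothesis n_gt0 : (0 < n)%N.
Hypothesis iI : is_ideal I.
Hypothesis RelI : forall p, Rel n s p -> I p.
Hypothesis bI : bi_ideal n s I.
Hypothesis hI : homogeneous n s I.
Hypothesis satI : forall p, I (vA s * p) -> exists q, I q /\ Rel n s (vA s * (p - q)).
Implicit Types (U S : {set 'I_s.+1}) (p q : A s).

Let iR : is_ideal (Rel n s) := gen_ideal_ideal _.

Definition modv (p : A s) : Prop := exists q, I (p - vA s * q).

Lemma modv_ideal : is_ideal modv.
Proof.
split=> [|p q [p' Ip] [q' Iq]|a p [p' Ip]].
- by exists 0; rewrite mulr0 subr0; apply: ideal0.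
- by exists (p' + q'); rewrite mulrDr opprD addrACA; apply: idealD.
- by exists (a * p'); rewrite mulrCA -mulrBr; apply: idealMl.
Qed.

Lemma modvW p : I p -> modv p.
Proof. by exists 0; rewrite mulr0 subr0. Qed.

Lemma modv_v p : modv (vA s * p).
Proof. by exists p; rewrite subrr; apply: ideal0. Qed.

(** The set [T] of the overview. Membership in [I + vH] is an arbitrary proposition, made boolean by
    excluded middle. *)
Definition tset : {set 'I_s.+1} :=
  [set i : 'I_s.+1 | (0 < i)%N && excluded_middle_informative (modv 'X_i)].

Lemma tsetP (i : 'I_s.+1) : reflect ((0 < i)%N /\ modv 'X_i) (i \in tset).
Proof.
rewrite inE; apply: (iffP andP) => -[i0 h]; split=> //.
  by move: h; case: excluded_middle_informative.
by case: excluded_middle_informative.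
Qed.

Lemma tset_double (i : nat) : (0 < i)%N -> (i.*2 <= s)%N ->
  (inord i : 'I_s.+1) \in tset -> (inord i.*2 : 'I_s.+1) \in tset.
Proof.
move=> i0 le /tsetP[_ mi]; apply/tsetP; split; first by rewrite inordK; lia.
have sq : I (eA s i ^+ 2 - eA s (2 * i)) by apply/RelI/Rel_sq; lia.
move: sq; rewrite mul2n !eAEn; [|lia|lia] => sq.
have -> : 'X_(inord i.*2) = 'X_(inord i) * 'X_(inord i) -
    ('X_(inord i) ^+ 2 - 'X_(inord i.*2)) :> A s by rewrite expr2; ring.
by apply: idealB modv_ideal _ _; [apply: idealMl modv_ideal _|apply: modvW].
Qed.

(** The indices of the generators not annihilated by the relations [v e_i = 0]. *)
Definition low : {set 'I_s.+1} := [set i : 'I_s.+1 | (0 < i < 2 ^ n)%N].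

Lemma low_pos : low \subset posi s.
Proof. by apply/subsetP => i; rewrite !inE => /andP[]. Qed.

Lemma posi_down : downclosed (posi s :\: tset).
Proof.
move=> i i0 le; rewrite !in_setD => /andP[h _].
rewrite [inord i \in posi s]inE inordK; last by lia.
by rewrite i0 andbT; apply: contra h; apply: tset_double.
Qed.

Lemma low_down : downclosed low.
Proof. by move=> i i0 le; rewrite !inE !inordK; lia. Qed.

Lemma lowD_down : downclosed (low :\: tset).
Proof.
move=> i i0 le; rewrite in_setD => /andP[h1 h2].
rewrite in_setD (low_down i0 le h2) andbT.
by apply: contra h1; apply: tset_double.
Qed.

(** For [U] inside [low] the relations [v e_i = 0] are seen only through some [e_i] outside [low],
    so arbitrary weights [phi] on the powers of [v] are compatible with them. *)
Lemma fA_Rel phi U p : U \subset low -> Rel n s p -> fA phi U p = 0.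
Proof.
move=> Ul Rp; suff h : forall a, fA phi U (a * p) = 0 by rewrite -[p]mul1r.
move: p Rp; apply: gen_ideal_min.
  split=> [a|p q Kp Kq a|c p Kp a]; first by rewrite mulr0 raddf0.
    by rewrite mulrDr raddfD /= Kp Kq addr0.
  by rewrite mulrA.
move=> g [[i [ile ->]] a|[i [ile ->]] a]; first exact: fA_sq.
rewrite mulrA; apply: (fA_out _ _ low_down Ul); first by move: (expn_gt0 2 n); lia.
by rewrite inE inordK; lia.
Qed.

Lemma counit0 p : (counit s p)@_0%MM = p@_0%MM.
Proof.
have cD : {morph counit s : p q / p + q} by move=> x y; apply: raddfD.
have cM : {morph counit s : p q / p * q} by move=> x y; apply: rmorphM.
have cC c : counit s c%:MP = c%:MP by apply: comp_mpolyC.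
have cX i : (counit s 'X_i)@_0%MM = 0.
  rewrite /counit comp_mpolyXU -tnth_nth tnth_mktuple.
  by case: eqP => _; rewrite ?mcoeff0 // vAE mcoeffX mnm1_eq0.
move: (counit s) cD cM cC cX => f cD cM cC cX.
elim/mpoly_ind_ring: p => [c|i|p q Ep Eq|p q Ep Eq]; first by rewrite cC.
- by rewrite cX mcoeffX mnm1_eq0.
- by rewrite cD !mcoeffD Ep Eq.
- by rewrite cM !rmorphM /= Ep Eq.
Qed.

(** The base of both inductions: the coefficient of [v^k] is the one that survives the counit, since
    a monomial containing some [e_i] never reduces to the empty set. *)
Lemma coef_set0 k p : I p -> coef k set0 p = 0.
Proof.
case/bI => c0 _; transitivity ((counit s p)@_(U_(ord0) *+ k)%MM); last by rewrite c0 mcoeff0.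
rewrite /counit comp_mpolyEX [RHS](raddf_sum (mcoeff _)) /coef /fA lextE /=.
apply: eq_bigr => m _; rewrite mcoeffZ; congr (_ * _).
rewrite comp_mpolyX (bigD1 ord0) //= tnth_mktuple eqxx vAE.
have [/existsP[i /andP[i0 mi]]|] := boolP [exists i : 'I_s.+1, (i != ord0) && (0 < m i)%N].
  rewrite [in RHS](bigD1 i) //= tnth_mktuple ifF; last by apply: negbTE.
  rewrite expr0n eqn0Ngt mi mul0r mulr0 mcoeff0.
  rewrite (_ : reduces _ _ = false) ?mulr0 //; apply/negP => red.
  have [|//|e [_ _]] := reduces_carry (i := i) (d := 0) red; last by rewrite inE.
    by rewrite lt0n i0 -ltnS ltn_ord.
  by rewrite /expA inord_val.
rewrite negb_exists => /forallP h; rewrite big1 => [|i i0]; last first.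
  by have := h i; rewrite i0 /= -eqn0Ngt => /eqP->; rewrite expr0.
rewrite mulr1 mpolyXn mcoeffX.
rewrite (_ : reduces _ _ = true); last first.
  have E : (set0 : {set 'I_s.+1}) == set0 by [].
  rewrite -(reduces_indic (sub0set _) (sub0set _)) in E; rewrite -E; apply: eq_reduces.
  move=> j jle; rewrite /indic inE /expA; have := h (inord j).
  by rewrite inord_eq0 /= -?eqn0Ngt; [move/eqP|lia|lia].
rewrite mulr1; congr (nat_of_bool _)%:R; apply/eqP/eqP => [->//|E].
by have := congr1 (fun m : 'X_{1..s.+1} => m ord0) E; rewrite !mulmnE mnm1E eqxx !mul1n.
Qed.

Lemma eS_in (G : A s -> Prop) U (i : 'I_s.+1) : is_ideal G -> i \in U -> G 'X_i -> G (eS U).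
Proof. by move=> iG iU Gi; rewrite /eS (bigD1 i) //=; apply: idealMr. Qed.

Lemma set_shape U : U = set0 \/ exists2 i, i \in U & (U = [set i] \/ U != [set i]).
Proof.
have [->|/set0Pn[i iU]] := eqVneq U set0; [by left|right; exists i => //].
by have [->|] := eqVneq U [set i]; [left|right].
Qed.

Lemma coef0_out U p : U \subset posi s :\: tset -> I p -> coef 0 U p = 0.
Proof.
have E0 S q : coef 0 S q = fA (fun k => 0 ^+ k) S q.
  by apply: eq_fA => k; rewrite expr0n.
have Vp : posi s :\: tset \subset posi s := subsetDl _ _.
have Vo (i : 'I_s.+1) : (0 < i)%N -> i \notin posi s :\: tset ->
    kerB 0 (posi s :\: tset) (delta_var n s i).
  by move=> i0 iV; apply: delta_out => //; [apply: posi_down|left|left].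
have [w] := ubnP (swt U); elim: w U p => // w IH U p lt UV Ip.
have IH' S : S \subset posi s :\: tset -> (swt S < w)%N ->
    forall q, I q -> fA (fun k => 0 ^+ k) S q = 0.
  by move=> SV lt' q Iq; rewrite -E0; apply: IH.
have big S i q : S \subset posi s :\: tset -> (swt S <= w)%N -> i \in S -> S != [set i] ->
    I q -> coef 0 S q = 0.
  move=> SV le iS nS Iq; rewrite E0.
  apply: (fA_step n_gt0 iI bI Vp posi_down _ Vo SV iS nS) Iq; first by left.
  by move=> S' SV' lt'; apply: IH' => //; lia.
have [->|[i iU [Ui|nU]]] := set_shape U; [exact: coef_set0| |by apply: (big _ i)].
have [i0 iT] : (0 < i)%N /\ i \notin tset.
  by move/(subsetP UV): iU; rewrite in_setD => /andP[nT]; rewrite inE => ->.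
rewrite Ui; apply/eqP; apply: contraNT iT => c0; apply/tsetP; split=> //.
have wi : swt [set i] = i by rewrite /swt big_set1.
(* In degree [i] the term [e_i] is to be isolated modulo [I + vH]. *)
pose p1 := hcomp n s i p.
have Ip1 : I p1 by apply: hI.
have cE : coef 0 [set i] p1 = coef 0 [set i] p.
  by have := @coef_hcomp n s 0 [set i] p; rewrite wi mul0r subr0.
have nf := normal_form modv_ideal (subxx (posi s)) _ _ p1.
have {nf} : modv (p1 - \sum_(U : {set 'I_s.+1} | U \subset posi s)
     (\sum_(k < msize p1) coef k U p1 *: vA s ^+ k) * eS U).
  apply: nf => [j jle|j j0]; first by apply/modvW/RelI/Rel_sq.
  by rewrite inE j0.
have sz : (0 < msize p1)%N.
  rewrite lt0n msize_poly_eq0; apply: contraNneq c0 => p10.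
  by rewrite -cE p10 raddf0.
(* Every other term is divisible by [v], or meets [T], or has weight [i]. In the last case it is
   neither empty nor a singleton, and [big] applies because it covers non-singletons of weight up to
   [w]. *)
have term S : S \subset posi s -> S != [set i] ->
    modv ((\sum_(k < msize p1) coef k S p1 *: vA s ^+ k) * eS S).
  move=> Sp nS; rewrite mulr_suml.
  apply: (ideal_sum _ modv_ideal) => -[[|k] ltk] _ /=; last first.
    by rewrite -scalerAl exprS -mulrA scalerAr; apply: modv_v.
  have [[j jS jT]|SV] : (exists2 j, j \in S & j \in tset) \/ S \subset posi s :\: tset.
    have [SV|/subsetPn[j jS jV]] := boolP (S \subset posi s :\: tset); [by right|left].
    by exists j => //; move: jV; rewrite in_setD (subsetP Sp _ jS) andbT negbK.
    apply: (idealMl _ modv_ideal); by apply: (eS_in modv_ideal jS); case/tsetP: jT.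
  have [->|c1] := eqVneq (coef 0 S p1) 0.
    by rewrite scale0r mul0r; apply: (ideal0 modv_ideal).
  have := coef_hcomp_deg c1; rewrite mul0r subr0 => -[wS].
  have [S0|[j jS [Sj|nSj]]] := set_shape S.
  - by move: wS i0; rewrite S0 /swt big_set0 => ->.
  - case/eqP: nS; rewrite Sj; congr [set _]; apply: val_inj => /=.
    by rewrite wS Sj /swt big_set1.
  - by case/eqP: c1; apply: (big _ j) => //; rewrite -wS -wi -Ui; lia.
move=> mv; have {mv} := idealB modv_ideal (modvW Ip1) mv.
rewrite opprB addrC subrK (bigD1 [set i]) /=; last by rewrite sub1set inE.
move=> mv; have {mv} : modv ((\sum_(k < msize p1) coef k [set i] p1 *: vA s ^+ k) * eS [set i]).
  rewrite -[X in modv X](addrK (\sum_(S : {set 'I_s.+1} | (S \subset posi s) && (S != [set i]))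
     (\sum_(k < msize p1) coef k S p1 *: vA s ^+ k) * eS S)).
  apply: (idealB modv_ideal) => //.
  by apply: (ideal_sum _ modv_ideal) => S /andP[]; apply: term.
rewrite /eS big_set1 (bigD1 (Ordinal sz)) //= mulrDl => mv.
have {mv} : modv (coef 0 [set i] p1 *: vA s ^+ 0 * 'X_i).
  rewrite -[X in modv X](addrK ((\sum_(k < msize p1 | k != Ordinal sz)
      coef k [set i] p1 *: vA s ^+ k) * 'X_i)).
  apply: (idealB modv_ideal) => //; apply: (idealMr _ modv_ideal).
  apply: (ideal_sum _ modv_ideal) => -[[|k] ltk] //= _.
  by rewrite exprS scalerAr; apply: modv_v.
rewrite expr0 cE -scalerAl mul1r -mul_mpolyC => mv.
have {mv} := idealMl ((coef 0 [set i] p)^-1)%:MP modv_ideal mv.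
by rewrite mul_mpolyC mul_mpolyC scalerA mulVf // scale1r.
Qed.

Lemma dvd_v p : (forall m, m \in msupp p -> (0 < m ord0)%N) -> exists q, p = vA s * q.
Proof.
move=> h; exists (\sum_(m <- msupp p) p@_m *: 'X_[m - U_(ord0)]).
rewrite mulr_sumr {1}[p]mpolyE; apply: eq_big_seq => m /h m0.
by rewrite -scalerAr vAE -mpolyXD addmC submK // lep1mP -lt0n.
Qed.

Lemma coef_v k U p : coef k.+1 U (vA s * p) = coef k U p.
Proof. by rewrite /coef fA_v; apply: eq_fA. Qed.

Lemma swt1 (i : 'I_s.+1) : swt [set i] = i.
Proof. by rewrite /swt big_set1. Qed.

Lemma lowDP (i : 'I_s.+1) : i \in low :\: tset -> [/\ (0 < i)%N, (i < 2 ^ n)%N & i \notin tset].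
Proof. by rewrite in_setD => /andP[iT]; rewrite inE => /andP[]. Qed.

Lemma lowD_pos : low :\: tset \subset posi s.
Proof. exact: subset_trans (subsetDl _ _) low_pos. Qed.

Lemma lowD_posD : low :\: tset \subset posi s :\: tset.
Proof. exact: setSD low_pos. Qed.

(* Since [d < 2 ^ n], the coefficient of [v^k e_d], [k > 0], is read off in a degree [<= 0],
   where all monomials except 1 are divisible by [v]: saturation applies. *)
Lemma coef_single k (d : 'I_s.+1) p : d \in low :\: tset -> I p -> coef k [set d] p = 0.
Proof.
move=> dV; have [d0 dlt dT] := lowDP dV; elim: k p => [|k IH] p Ip.
  by apply: coef0_out => //; rewrite sub1set (subsetP lowD_posD).
pose p1 := hcomp n s (d%:Z - k.+1%:Z * ((2 ^ n)%:Z - 1)) p.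
have <- : coef k.+1 [set d] p1 = coef k.+1 [set d] p.
  by have := @coef_hcomp n s k.+1 [set d] p; rewrite swt1.
have Ip1 : I p1 by apply: hI.
have [m mp|p2 E2] := @dvd_v p1.
  rewrite lt0n; apply/negP => /eqP m0; have := msupp_hcomp mp.
  rewrite wdegE m0 mul0r subr0 => E.
  have E' : (fwt s (expA m) + k.+1 * (2 ^ n - 1))%N = d.
    by apply/eqP; rewrite -eqz_nat PoszD PoszM -subzn ?expn_gt0 // E subrK.
  have f0 : fwt s (expA m) = 0%N.
    have h : (2 ^ n - 1 <= k.+1 * (2 ^ n - 1))%N by rewrite leq_pmull.
    by move: h E' dlt; move: (k.+1 * (2 ^ n - 1))%N => x; lia.
  have mE : m = 0%MM.
    apply/mnmP => i; rewrite mnm0E; have [->//|i0] := eqVneq i ord0.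
    apply/eqP; rewrite -leqn0 leqNgt; apply/negP => mi.
    have i1 : (0 < i <= s)%N by move: (ltn_ord i) i0; rewrite -val_eqE /=; lia.
    have := fwt_ge (f := expA m) i1; rewrite {1}/expA inord_val f0 => /(_ mi).
    by move: i1; lia.
  move: mp; rewrite mE mcoeff_msupp -counit0; have [-> _] := bI Ip1.
  by rewrite mcoeff0 eqxx.
(* Saturation yields [q] in [I] with [v q = v p2] in [H]; the wanted coefficient is thus that of
   [v^k e_d] in [q], which vanishes by induction on [k]. *)
rewrite E2 in Ip1 *; have [q [Iq Rq]] := satI Ip1; rewrite coef_v.
have dl : [set d] \subset low by rewrite sub1set inE d0.
have := fA_Rel (fun j => (j == k.+1)%:R) dl Rq; rewrite -/(coef k.+1 [set d] _) coef_v.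
by rewrite raddfB /= (IH q Iq) subr0.
Qed.

Lemma fA1_coef U p : (forall k, coef k U p = 0) -> fA (fun k => 1 ^+ k) U p = 0.
Proof.
by move=> c0; rewrite (@fA_coef _ _ _ _ (msize p)) // big1 // => k _; rewrite c0 mul0r.
Qed.

(** As [v] has degree [1 - 2^n], the relevant component of [q] has degree [swt S + 2^n - 1]. So each
    [e_U] occurring in it is heavier than [e_S], which drives the later inductions. *)
Lemma lift_homogeneous S q : S \subset posi s -> I (eS S - vA s * q) ->
  exists q', I (eS S - vA s * q') /\
    forall k U, coef k U q' != 0 -> swt U = (swt S + k.+1 * (2 ^ n - 1))%N.
Proof.
move=> Sp Iq; exists (hcomp n s ((swt S)%:Z + ((2 ^ n)%:Z - 1)) q); split.
  have := hI Iq (swt S); rewrite (raddfB (hcomp n s (swt S))) /=.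
  by rewrite hcomp_eS // hcomp_vA.
move=> k U /coef_hcomp_deg E; apply/eqP; rewrite -eqz_nat PoszD PoszM -subzn ?expn_gt0 //.
by rewrite intS mulrDl mul1r addrA E subrK.
Qed.

Lemma eS1 (i : 'I_s.+1) : eS [set i] = 'X_i.
Proof. by rewrite /eS big_set1. Qed.

Lemma low_out (i : 'I_s.+1) : (0 < i)%N -> i \notin low -> kerB 1 low (delta_var n s i).
Proof.
move=> i0 il; apply: (delta_out n_gt0 low_pos low_down _ i0 il) => [|_ lt _].
  by right=> j; rewrite inE => /andP[].
by move: il; rewrite inE i0 lt.
Qed.

(** The value comes from the term [v e_<k> (x) e_<k>] of the coproduct of [e_<2k>]. *)
Lemma fB_Delta_mid (t e : 'I_s.+1) : odd t -> (t < 2 ^ n - 1)%N -> dmid n t = e ->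
  fB 1 [set e] [set e] (Delta n s (eS [set t])) = 1.
Proof.
move=> ot lt ee; have N0 : (0 < 2 ^ n)%N by rewrite expn_gt0.
have t0 := odd_gt0 ot.
have E2 := dmidE n_gt0 ot (ltac:(lia) : (t < 2 ^ n)%N).
have e0 : (0 < e)%N by lia.
have ep : [set e] \subset posi s by rewrite sub1set inE.
have tp : [set t] \subset posi s by rewrite sub1set inE.
have el : [set e] \subset low by rewrite sub1set inE; lia.
rewrite eS1 Delta_X // delta_var_odd // delta_oddE // !raddfD /=.
have -> : fB 1 [set e] [set e] (ex s t) = 0.
  have := @fB_mon s 1 _ _ [set t] set0 ep ep tp (sub0set _).
  rewrite /monX /monY big_set1 big_set0 mulr1 => ->.
  by rewrite [set0 == _]eq_sym -cards_eq0 cards1 andbF.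
have -> : fB 1 [set e] [set e] (ey s t) = 0.
  have := @fB_mon s 1 _ _ set0 [set t] ep ep (sub0set _) tp.
  rewrite /monX /monY big_set1 big_set0 mul1r => ->.
  by rewrite [set0 == _]eq_sym -cards_eq0 cards1.
rewrite !add0r /delta_red lt big_ord_recl big_ord0 mulr1 /=.
have ea : angle n ((2 ^ n - 1 - t) %/ 2) = e by rewrite -ee.
rewrite expn0 divn1 ea raddfD /= -mulrA.
rewrite (@fB_vexp s 1 low) //.
have -> : ex s e * ey s e = monX [set e] * monY [set e] by rewrite /monX /monY !big_set1.
rewrite fB_mon // !eqxx expr1n mul1r.
(* The terms with [i > 0] have two factors of weight at least [e] and a further one of weight [e],
   hence total weight at least [3e > 2e]. *)
rewrite (@fB_filt _ _ _ _ (e + e).+1) ?addr0 ?swt1 //.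
apply: (ideal_sum _ (filt_ideal s _)) => i _.
rewrite /bump /= add1n big_ord_recl /= expn0 divn1 ea.
apply: (@filtW _ (0 + (e + e) + (e + 0))); first by lia.
rewrite -mulrA; rewrite mulrA -[_ * _ * ey _ _]mulrA; apply: filtM.
  apply: filtM; first exact: filt_any.
  have ge : (e <= angle n ((2 ^ n - 1 - t) %/ 2 %/ 2 ^ i.+1))%N.
    by rewrite -ea /angle leq_sub2l // leq_div.
  by apply: filtM; [apply: (filtW ge); apply: filt_x|apply: (filtW ge); apply: filt_y].
apply: filtM; last exact: filt_any.
by apply: filtD; [apply: filt_x|apply: filt_y].
Qed.

(** Otherwise write [e_t = v q] modulo [I] with [q] homogeneous. On the coproduct of [e_t - v q] the
    functional of [{e}], [{e}] with [e = <k>] vanishes by [coef_single], whereas [e_t] contributes 1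
    and [q] contributes 0. *)
Lemma tset_mid (t : 'I_s.+1) : t \in tset -> odd t -> (t < 2 ^ n)%N -> (dmid n t <= s)%N ->
  (inord (dmid n t) : 'I_s.+1) \in tset.
Proof.
move=> tT ot tlt les; apply: contraT => eT.
have t0 := odd_gt0 ot; have E2 := dmidE n_gt0 ot tlt.
have [tn|tn] := eqVneq (t : nat) (2 ^ n - 1)%N.
  by case/negP: eT; rewrite (_ : inord _ = t) //; apply: val_inj; rewrite /= inordK //; lia.
set e : 'I_s.+1 := inord (dmid n t) in eT *.
have ee : dmid n t = e by rewrite /e inordK.
have eV : e \in low :\: tset by rewrite in_setD eT inE -ee; lia.
have el : [set e] \subset low by rewrite sub1set; case/setDP: eV.
have tp : [set t] \subset posi s by rewrite sub1set inE.
have tl : [set t] \subset low by rewrite sub1set inE t0.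
have [_ [q0 Iq0]] := tsetP _ tT; rewrite -eS1 in Iq0.
have [q [Iq qdeg]] := lift_homogeneous tp Iq0.
have Ke p : I p -> fA (fun k => 1 ^+ k) [set e] p = 0.
  by move=> Ip; apply: fA1_coef => k; apply: coef_single.
have := fB_biideal iI bI Ke Ke Iq.
have Ve : 1 = 0 :> F2 \/ (forall i, i \in low -> (i < 2 ^ n)%N).
  by right=> i; rewrite inE => /andP[].
rewrite (fB_Delta n_gt0 low_pos low_down Ve low_out _ el el).
(* The terms of [q] have weight at least [t + 2^n - 1 = 2e]. *)
have fq S : fA (fun k => 1 ^+ k) S q != 0 -> (e + e <= swt S)%N.
  move=> nz; have [/existsP[k /qdeg->]|] :=
    boolP [exists k : 'I_(msize q), coef k S q != 0].
    by rewrite swt1 mulSn -ee addnn E2 addnA leq_addr.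
  rewrite negb_exists => /forallP h; case/eqP: nz.
  rewrite (@fA_coef _ _ _ _ (msize q)) // big1 // => k _.
  by have := h k; rewrite negbK => /eqP->; rewrite mul0r.
have fE S : S \subset low -> fA (fun k => 1 ^+ k) S (eS [set t] - vA s * q) =
    ([set t] == S)%:R - fA (fun k => 1 ^+ k) S q.
  move=> Sl; rewrite raddfB /= fA_eS ?(subset_trans Sl low_pos) // mul1r fA_v.
  by congr (_ - _); apply: eq_fA => k; rewrite !expr1n.
(* In this weight range only the leading terms [e_U (x) e_(S - U)] count, and their two index sets
   are disjoint, unlike [{e}] and [{e}]. *)
have kap S : S \subset low -> (e + e <= swt S)%N ->
    fB 1 [set e] [set e] (Delta n s (eS S)) = 0.
  move=> Sl le; rewrite (fB_Delta_eq n_gt0 low_pos low_down Ve el el Sl) ?swt1 //.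
  case: eqP => [E|_]; last by rewrite andbF.
  by have := set11 e; rewrite -E !inE eqxx.
have := fB_Delta_mid ot (ltac:(lia) : (t < 2 ^ n - 1)%N) ee.
move: (Delta n s) kap => D kap D1.
rewrite (bigD1 [set t] tl) /= D1 mulr1 fE // eqxx big1 => [|S /andP[Sl nS]]; last first.
  rewrite fE // eq_sym (negbTE nS) sub0r mulNr.
  have [->|/fq le] := eqVneq (fA (fun k => 1 ^+ k) S q) 0; first by rewrite mul0r oppr0.
  by rewrite kap // mulr0 oppr0.
have -> : fA (fun k => 1 ^+ k) [set t] q = 0.
  by apply/eqP; apply: contraT => /fq; rewrite swt1; lia.
by rewrite subr0 addr0 => /eqP; rewrite oner_eq0.
Qed.

(** The induction of [coef0_out] with [v = 1]: [tset_mid] supplies the stability required by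
    [delta_out], and [coef_single] treats singletons. *)
Lemma fA1_out U p : U \subset low :\: tset -> I p -> fA (fun k => 1 ^+ k) U p = 0.
Proof.
have Ve : 1 = 0 :> F2 \/ (forall i, i \in low :\: tset -> (i < 2 ^ n)%N).
  by right=> i /lowDP[].
have Vo (i : 'I_s.+1) : (0 < i)%N -> i \notin low :\: tset ->
    kerB 1 (low :\: tset) (delta_var n s i).
  move=> i0 iV; apply: (delta_out n_gt0 lowD_pos lowD_down Ve i0 iV) => oi lt le.
  right; rewrite in_setD negb_and negbK tset_mid //.
  by move: iV; rewrite in_setD negb_and negbK => /orP[//|]; rewrite inE i0 lt.
have [w] := ubnP (swt U); elim: w U p => // w IH U p lt UV Ip.
have [->|[i iU [Ui|nU]]] := set_shape U.
- by apply: fA1_coef => k; apply: coef_set0.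
- rewrite Ui; apply: fA1_coef => k; apply: coef_single => //.
  exact: (subsetP UV).
apply: (fA_step n_gt0 iI bI lowD_pos lowD_down Ve Vo UV iU nU) Ip.
by move=> S SV lt' q Iq; apply: IH => //; lia.
Qed.

(** In a fixed degree [U] determines [k], because [2^n - 1] is nonzero. So for a homogeneous element
    nothing is lost by specialising [v] to 1. *)
Lemma coef_out k U p : U \subset low :\: tset -> I p -> coef k U p = 0.
Proof.
move=> UV Ip; have N1 : (1 < 2 ^ n)%N by rewrite -{1}(expn0 2) ltn_exp2l.
have := fA1_out UV (hI Ip ((swt U)%:Z - k%:Z * ((2 ^ n)%:Z - 1))).
have := @coef_hcomp n s k U p; set p1 := hcomp _ _ _ _ => <-.
have [lt|ge] := ltnP k (msize p1).
  rewrite (@fA_coef _ _ _ _ (msize p1)) // (bigD1 (Ordinal lt)) //= expr1n mulr1 big1 ?addr0 //.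
  move=> j nj; have [->|/coef_hcomp_deg] := eqVneq (coef j U p1) 0; first by rewrite mul0r.
  move/addrI/oppr_inj/mulIf => E; case/eqP: nj; apply: val_inj => /=.
  have /E[->] : (2 ^ n)%:Z - 1 != 0 by lia.
  by [].
move=> _; apply/eqP; apply: contraT => /fA_neq0[m [mp _]].
have [mk _|_] := eqVneq (m ord0) k; last by rewrite eqxx.
move: ge; rewrite leqNgt -mk => /negP[]; apply: leq_ltn_trans (msize_mdeg_lt mp).
by rewrite mdegE (bigD1 ord0) //= leq_addr.
Qed.

(** It suffices that [v q] lies in [I]. Terms of [q] leaving [low] are killed by [v], and those
    disjoint from [T] have coefficient 0 by [coef_out] applied to [e_S - v q]; the remaining ones
    are left to the hypothesis. *)
Lemma eS_lift S q : S \subset posi s -> I (eS S - vA s * q) ->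
  (forall U, U \subset low -> ~~ (U \subset low :\: tset) ->
     (exists k, coef k U q != 0) -> I (eS U)) -> I (eS S).
Proof.
move=> Sp Iq h; rewrite -[eS S](subrK (vA s * q)); apply: (idealD iI) => //.
have iG : is_ideal (fun x => Rel n s (vA s * x)).
  split=> [|x y Rx Ry|a x Rx]; first by rewrite mulr0; apply: (ideal0 iR).
    by rewrite mulrDr; apply: (idealD iR).
  by rewrite mulrCA; apply: (idealMl _ iR).
have nf : Rel n s (vA s * (q - \sum_(U : {set 'I_s.+1} | U \subset low)
     (\sum_(k < msize q) coef k U q *: vA s ^+ k) * eS U)).
  apply: (normal_form iG low_pos) => [i ile|i i0 il].
    by apply: (idealMl _ iR); apply: Rel_sq.
  rewrite -eAE //; apply: Rel_v_eA; move: il; rewrite inE i0 /=; lia.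
rewrite mulrBr in nf; rewrite -[vA s * q](subrK (vA s * \sum_(U : {set 'I_s.+1} | U \subset low)
     (\sum_(k < msize q) coef k U q *: vA s ^+ k) * eS U)).
apply: (idealD iI); first exact: RelI.
apply: (idealMl _ iI); apply: (ideal_sum _ iI) => U Ul.
have [UV|UV] := boolP (U \subset low :\: tset).
  rewrite big1 ?mul0r; first exact: (ideal0 iI).
  move=> k _; rewrite -coef_v (_ : coef _ U _ = 0) ?scale0r //.
  have := coef_out k.+1 UV Iq; rewrite raddfB /= => /eqP; rewrite subr_eq0 => /eqP <-.
  by rewrite [coef _ _ _]fA_eS ?(subset_trans UV lowD_pos) // mul0r.
have [/existsP[k nz]|] := boolP [exists k : 'I_(msize q), coef k U q != 0].
  by apply: (idealMl _ iI); apply: h => //; exists k.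
rewrite negb_exists => /forallP c0; rewrite big1 ?mul0r; first exact: (ideal0 iI).
by move=> k _; have := c0 k; rewrite negbK => /eqP->; rewrite scale0r.
Qed.

Lemma meets_tset U : U \subset low -> ~~ (U \subset low :\: tset) ->
  exists2 t, t \in U & t \in tset.
Proof.
move=> Ul /subsetPn[t tU]; rewrite in_setD (subsetP Ul _ tU) andbT negbK => tT.
by exists t.
Qed.

Lemma tset_eS S (t : 'I_s.+1) : t \in S -> t \in tset -> exists q, I (eS S - vA s * q).
Proof.
move=> tS /tsetP[_ mt]; exact: (eS_in modv_ideal tS mt).
Qed.

(** Descending induction on weight: modulo [I], [e_S] is [v] times a combination of strictly heavier
    [e_U], and weights are bounded by that of the full index set. *)
Lemma eS_low S (t : 'I_s.+1) : S \subset low -> t \in S -> t \in tset -> I (eS S).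
Proof.
have N1 : (1 < 2 ^ n)%N by rewrite -{1}(expn0 2) ltn_exp2l.
have wle U : (swt U <= swt [set: 'I_s.+1])%N.
  rewrite /swt [X in (_ <= X)%N](bigID (mem U)) /=.
  rewrite [X in (_ <= X + _)%N](eq_bigl (mem U)) ?leq_addr // => i.
  by rewrite inE.
have [w] := ubnP (swt [set: 'I_s.+1] - swt S)%N.
elim: w S t => // w IH S t lt Sl tS tT.
have Sp := subset_trans Sl low_pos.
have [q0 Iq0] := tset_eS tS tT.
have [q [Iq qdeg]] := lift_homogeneous Sp Iq0.
apply: (eS_lift Sp Iq) => U Ul UV [k /qdeg wU].
have [t' tU tT'] := meets_tset Ul UV; apply: (IH U t') => //.
have ltU : (swt S < swt U)%N by rewrite wU -addn1 leq_add2l muln_gt0 subn_gt0 N1.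
by move: lt (wle U) ltU; lia.
Qed.

(** Since [t] may be at least [2^n], one application of [eS_lift] first moves the problem inside
    [low]. *)
Lemma tset_in (t : 'I_s.+1) : t \in tset -> I 'X_t.
Proof.
move=> tT; have tp : [set t] \subset posi s by rewrite sub1set inE; case/tsetP: tT.
have [q Iq] := tset_eS (set11 t) tT; rewrite -eS1.
apply: (eS_lift tp Iq) => U Ul UV _; have [t' tU tT'] := meets_tset Ul UV.
exact: (eS_low Ul tU tT').
Qed.

(** Modulo [J] only sets disjoint from [T] remain in the normal form. Their terms vanish by
    [coef_out] inside [low] and by [coef0_out] for [k = 0]; for [k > 0] outside [low] they are
    multiples of a relation [v e_i]. *)
Lemma biideal_gen (J : A s -> Prop) : is_ideal J -> (forall p, Rel n s p -> J p) ->
  (forall t, t \in tset -> J 'X_t) -> forall p, I p -> J p.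
Proof.
move=> iJ RJ TJ p Ip.
have nf : J (p - \sum_(U : {set 'I_s.+1} | U \subset posi s :\: tset)
     (\sum_(k < msize p) coef k U p *: vA s ^+ k) * eS U).
  apply: (normal_form iJ (subsetDl _ _)) => [i ile|i i0 iV]; first by apply/RJ/Rel_sq.
  by apply: TJ; move: iV; rewrite in_setD negb_and negbK [i \in posi s]inE i0 orbF.
rewrite -[p](subrK (\sum_(U : {set 'I_s.+1} | U \subset posi s :\: tset)
     (\sum_(k < msize p) coef k U p *: vA s ^+ k) * eS U)).
apply: (idealD iJ) => //; apply: (ideal_sum _ iJ) => U UV.
rewrite mulr_suml; apply: (ideal_sum _ iJ) => -[k ltk] _ /=.
have [Ul|/subsetPn[i iU il]] := boolP (U \subset low).
  rewrite coef_out // ?scale0r ?mul0r; first exact: (ideal0 iJ).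
  apply/subsetP => i iU; move: (subsetP UV _ iU).
  by rewrite !in_setD (subsetP Ul) // => /andP[->].
case: k ltk => [|k] ltk; first by rewrite coef0_out // scale0r mul0r; apply: (ideal0 iJ).
have i0 : (0 < i)%N by move: (subsetP UV _ iU); rewrite in_setD => /andP[_]; rewrite inE.
rewrite -scalerAl -mul_mpolyC exprSr -mulrA; apply: (idealMl _ iJ); apply: (idealMl _ iJ).
rewrite /eS (bigD1 i) //= mulrA; apply: (idealMr _ iJ); apply: RJ.
by rewrite -eAE //; apply: Rel_v_eA; move: il; rewrite inE i0 /=; lia.
Qed.

Lemma Rel_pow2 o c : (0 < o <= s)%N -> Rel n s (eA s o ^+ (2 ^ c) - eA s (o * 2 ^ c)).
Proof.
move=> ole; elim: c => [|c IH]; first by rewrite expr1 muln1 subrr; apply: (ideal0 iR).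
have E : (o * 2 ^ c.+1 = 2 * (o * 2 ^ c))%N by rewrite expnS mulnCA.
have c0 : (0 < o * 2 ^ c)%N by rewrite muln_gt0 expn_gt0; case/andP: ole => ->.
have -> : eA s o ^+ (2 ^ c.+1) - eA s (o * 2 ^ c.+1) =
    (eA s o ^+ (2 ^ c) + eA s (o * 2 ^ c)) * (eA s o ^+ (2 ^ c) - eA s (o * 2 ^ c)) +
    (eA s (o * 2 ^ c) ^+ 2 - eA s (2 * (o * 2 ^ c))).
  by rewrite E expnSr exprM; ring.
apply: (idealD iR); first exact: (idealMl _ iR).
have [le|lt] := leqP (o * 2 ^ c) s; first by apply: Rel_sq; rewrite c0.
by rewrite !eA0 ?expr0n ?subrr //; [apply: (ideal0 iR)|lia].
Qed.

(** The generators [e_t], [t] in [T], are grouped by the odd part of [t]. In each group they are all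
    multiples of the smallest 2-power of [e_o] that occurs. *)
Lemma biideal_structure : exists a : nat -> nat,
  forall p, I p <->
    gen_ideal (fun q => RelGen n s q \/
                 exists k, (1 <= k <= (s.+1)./2)%N /\
                           q = eA s (k.*2.-1) ^+ (2 ^ a k)) p.
Proof.
(* The exponent [a_k] is the least [c] for which [e_((2k-1) 2^c)] lies in [T] or is zero by
   exceeding [s]. The disjunct [k == 0] only makes the exponent defined at 0, where [k.*2.-1] is
   0. *)
pose P k c := [|| k == 0%N, s < k.*2.-1 * 2 ^ c |
  (inord (k.*2.-1 * 2 ^ c) : 'I_s.+1) \in tset]%N.
have exP k : exists c, P k c.
  exists s; rewrite /P; case: k => //= k; apply/orP; left.
  by rewrite (leq_trans (ltn_expl s (isT : (1 < 2)%N))) // leq_pmull.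
exists (fun k => ex_minn (exP k)) => p; set G := (fun q => _ \/ _).
have iG : is_ideal (gen_ideal G) := gen_ideal_ideal _.
have RG q : Rel n s q -> gen_ideal G q.
  apply: gen_ideal_min => // g Rg; apply: gen_ideal_mem; by left.
split; last first.
  apply: gen_ideal_min => // g [Rg|[k [kle ->]]]; first exact/RelI/gen_ideal_mem.
  case: ex_minnP => c Pc _; have ole : (0 < k.*2.-1 <= s)%N by lia.
  rewrite -[_ ^+ _](subrK (eA s (k.*2.-1 * 2 ^ c))); apply: (idealD iI).
    exact/RelI/Rel_pow2.
  case/or3P: Pc => [/eqP k0|lt|cT]; first by move: kle; rewrite k0.
    by rewrite eA0 //; apply: (ideal0 iI).
  have [le|lt] := leqP (k.*2.-1 * 2 ^ c) s; last by rewrite eA0 //; apply: (ideal0 iI).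
  rewrite eAEn; first exact: tset_in.
  by rewrite le andbT muln_gt0 expn_gt0; case/andP: ole => ->.
apply: biideal_gen => // t tT; have t0 : (0 < t)%N by case/tsetP: tT.
have [o [c [oo Et]]] := odd_pow2P t0.
have ole : (0 < o <= s)%N.
  rewrite odd_gt0 //= -ltnS; apply: (@odd_le_self s o c); by rewrite -Et -ltnS.
pose k := (o.+1)./2.
have ok : k.*2.-1 = o by rewrite /k; move: (odd_double_half o); rewrite oo; lia.
have kle : (1 <= k <= (s.+1)./2)%N by rewrite /k; lia.
have Ga : gen_ideal G (eA s o ^+ (2 ^ ex_minn (exP k))).
  by apply: gen_ideal_mem; right; exists k; rewrite ok.
have le : (ex_minn (exP k) <= c)%N.
  by case: ex_minnP => c' _ /(_ c); apply; rewrite /P ok -Et inord_val tT !orbT.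
have -> : 'X_t = eA s o ^+ (2 ^ c) - (eA s o ^+ (2 ^ c) - eA s (o * 2 ^ c)).
  by rewrite opprB addrC subrK -Et eAE.
apply: (idealB iG); last exact/RG/Rel_pow2.
(* As [a_k <= c], the power [e_o^(2^c)] is a multiple of the generator [e_o^(2^(a_k))]. *)
rewrite -(subnK le) addnC expnD exprM.
have : (0 < 2 ^ (c - ex_minn (exP k)))%N by rewrite expn_gt0.
by case: (2 ^ _)%N => // N _; rewrite exprS; apply: (idealMr _ iG).
Qed.

End BiIdealStructure.

(** The choice of [m_0] thus retains in [H_0] exactly the generators [e_i] of [H] with [i < 2^n], as
    the saturation argument requires. *)
Lemma sOf_m0Of n m : sOf (m0Of n m) = minn (sOf m) (2 ^ n - 1).
Proof.
have : (0 < 2 ^ n)%N by rewrite expn_gt0.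
by rewrite /m0Of /sOf expnS; case: ifP => h; [|case: ifP => om]; lia.
Qed.

Theorem theorem4p8 (n m : nat) (hn : (1 <= n)%N) (hm : (1 <= m)%N)
  (I : {mpoly 'F_2[(sOf m).+1]} -> Prop)
  (hI : is_ideal I)
  (hRel : forall p, Rel n (sOf m) p -> I p)
  (hbi : bi_ideal n (sOf m) I)
  (hhom : homogeneous n (sOf m) I)
  (hsat : saturated (sOf (m0Of n m))
            (image_ideal n (sOf m) (sOf (m0Of n m)) I)) :
  exists a : nat -> nat,
    forall p, I p <->
      gen_ideal (fun q => RelGen n (sOf m) q \/
                   exists k, (1 <= k <= ((sOf m).+1)./2)%N /\
                             q = eA (sOf m) (k.*2.-1) ^+ (2 ^ a k)) p.
Proof.
have sat := saturated_lift (sOf_m0Of n m) hsat.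
exact: (biideal_structure hn hI hRel hbi hhom sat).
Qed.
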